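(* There are universal constants $c,C>0$ such that the following holds. Let $X\sim N(0,\Sigma)$ be an SDD, $\kappa$-nondegenerate Gaussian graphical model on $n$ nodes with maximum degree $d\ge 1$, and let $\delta\in(0,1)$. Set $\nu=\kappa^2/8$ and $T=\lceil c\,d/\kappa^2\rceil$ (so $T=\Theta(d/\kappa^2)$). If the number of i.i.d. samples satisfies $m\ge C\,\frac{d^2}{\kappa^6}\log(n/\delta)$, then with probability at least $1-\delta$, for every node $i$ the algorithm \textsc{GreedyAndPrune}$(i,\nu,T)$ returns exactly the set of neighbors of $i$.
   Context: A Gaussian graphical model (GGM) on $n$ nodes is a Gaussian vector $X=(X_1,\dots,X_n)\sim N(0,\Sigma)$ with invertible covariance $\Sigma$ and precision matrix $\Theta=\Sigma^{-1}$. Its graph has vertex set $\{1,\dots,n\}$, with distinct $i,j$ adjacent (neighbors) iff $\Theta_{ij}\neq0$. For $\kappa\in(0,1]$, the GGM is $\kappa$-nondegenerate if $|\Theta_{ij}|/\sqrt{\Theta_{ii}\Theta_{jj}}\ge\kappa$ for all $i\ne j$ with $\Theta_{ij}\ne0$. The GGM is SDD if $\Theta_{ii}\ge\sum_{j\neq i}|\Theta_{ij}|$ for every $i$. Given $m$ i.i.d. samples, let $\mathbb X$ be the $m\times n$ matrix whose rows are the samples and $\mathbb X_i$ its $i$-th column. For $S\subset\{1,\dots,n\}\setminus\{i\}$, the estimated conditional variance is $\widehat{\mathrm{Var}}(X_i\mid X_S)=\frac{1}{m-|S|}\min_{w:\,\mathrm{supp}(w)\subset S}\|\mathbb X_i-\mathbb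 Xw\|_2^2$. Orthogonal matching pursuit (OMP) run for $T$ steps to predict $\mathbb X_i$ from the other columns: $S_0=\emptyset$; for $t=1,\dots,T$ choose $j\ne i$ minimizing $\min_{w:\,\mathrm{supp}(w)\subset S_{t-1}\cup\{j\}}\|\mathbb X_i-\mathbb Xw\|_2^2$ and set $S_t=S_{t-1}\cup\{j\}$; output $S_T$. (The procedure stops if all other columns have been selected.) \textsc{GreedyAndPrune}$(i,\nu,T)$: (1) run OMP for $T$ steps to predict $\mathbb X_i$ from the other columns, and let $S$ be the output; (2) define $\hat\Theta_{ii}$ by $1/\hat\Theta_{ii}=\widehat{\mathrm{Var}}(X_i\mid X_S)$; (3) for each $j$ in (the initial) $S$, one after another: let $S'=S\setminus\{j\}$ for the current $S$, and if $\widehat{\mathrm{Var}}(X_i\mid X_{S'})-\widehat{\mathrm{Var}}(X_i\mid X_S)<\nu/\hat\Theta_{ii}$, replace $S$ by $S'$; (4) return $S$. *)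

(* Defs.v *)
From HB Require Import structures.
From mathcomp Require Export all_boot all_order all_algebra.
From mathcomp Require Export all_classical all_reals all_analysis.

Set Implicit Arguments.
Unset Strict Implicit.
Unset Printing Implicit Defensive.
Import Order.TTheory GRing.Theory Num.Theory.
Import numFieldNormedType.Exports.

Local Open Scope classical_set_scope.
Local Open Scope ring_scope.

Section GaussianSamples.
Context {R : realType}.

Definition covariance_matrix n (Sigma : 'M[R]_n) : Prop :=
  Sigma^T = Sigma /\ forall u : 'rV[R]_n, 0 <= (u *m Sigma *m u^T) 0 0.

(* The law N(0, v).  The case v = 0 is separate because [normal_prob 0 0] is,
   by the convention of [normal_pdf], the uniform law on [0, 1]. *)
Definition centered_normal (v : R) (A : set R) : \bar R :=
  if v == 0 then dirac (0 : R) A else normal_prob 0 (Num.sqrt v) A.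

Context {disp : measure_display} {Omega : measurableType disp}.
Variable P : probability Omega R.

(* X ~ N(0, Sigma): every linear combination u_1 X_1 + ... + u_n X_n has law
   N(0, u Sigma u^T).  Here R^n is [n.-tuple R] with its product
   sigma-algebra. *)
Definition gaussian_vector n (X : {RV P >-> n.-tuple R})
    (Sigma : 'M[R]_n) : Prop :=
  forall (u : 'rV[R]_n) (A : set R), measurable A ->
    P [set w | A (\sum_(i < n) u 0 i * tnth (X w) i)] =
    centered_normal ((u *m Sigma *m u^T) 0 0) A.

Definition mutually_independent m n
    (X : 'I_m -> {RV P >-> n.-tuple R}) : Prop :=
  forall (J : {set 'I_m}) (B : 'I_m -> set (n.-tuple R)),
    (forall k, measurable (B k)) ->
    P [set w | forall k, k \in J -> B k (X k w)] =
    (\prod_(k in J) P (X k @^-1` B k))%E.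

Definition iid_gaussian_samples m n
    (X : 'I_m -> {RV P >-> n.-tuple R}) (Sigma : 'M[R]_n) : Prop :=
  (forall k, gaussian_vector (X k) Sigma) /\ mutually_independent X.

Definition data_matrix m n (X : 'I_m -> {RV P >-> n.-tuple R}) (w : Omega) :
  'M[R]_(m, n) := \matrix_(k, i) tnth (X k w) i.

End GaussianSamples.

Section GraphicalModel.
Context {R : realType} {n : nat}.
Implicit Type Theta : 'M[R]_n.

Definition precision (Sigma : 'M[R]_n) : 'M[R]_n := invmx Sigma.

Definition neighbors Theta (i : 'I_n) : {set 'I_n} :=
  [set j | (j != i) && (Theta i j != 0)].

Definition max_degree Theta : nat := \max_(i < n) #|neighbors Theta i|.

Definition nondegenerate (kappa : R) Theta : Prop :=
  forall i j, i != j -> Theta i j != 0 ->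
    kappa <= `|Theta i j| / Num.sqrt (Theta i i * Theta j j).

Definition SDD Theta : Prop :=
  forall i, \sum_(j < n | j != i) `|Theta i j| <= Theta i i.

End GraphicalModel.

Section Algorithms.
Context {R : realType} {m n : nat}.
Variables (X : 'M[R]_(m, n)) (i : 'I_n).

Definition sqnorm (v : 'cV[R]_m) : R := \sum_(k < m) v k 0 ^+ 2.

(* min_{w : supp w \subset S} ||X_i - X w||^2; a least-squares minimum is
   always attained, so it is the infimum. *)
Definition rss (S : {set 'I_n}) : R :=
  inf [set sqnorm (col i X - X *m w) |
       w in [set w : 'cV[R]_n | forall j, w j 0 != 0 -> j \in S]].

Definition cond_var (S : {set 'I_n}) : R := rss S / (m%:R - #|S|%:R).

(* The selection rule does not specify how ties are broken nor the order in
   which candidates are pruned, so the algorithms are relations: [omp T S] and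
   [greedy_and_prune nu T S] hold when S is a possible output.  [omp_step]
   stays put once every column other than i is selected. *)
Definition omp_step (S S' : {set 'I_n}) : Prop :=
  if S == [set~ i]%SET then S' = S else
  exists2 j, (j != i) /\ (forall k, k != i -> rss (j |: S) <= rss (k |: S))
           & S' = j |: S.

Fixpoint omp (T : nat) (S : {set 'I_n}) : Prop :=
  if T is T'.+1 then exists2 S0, omp T' S0 & omp_step S0 S else S = finset.set0.

Definition prune_step (threshold : R) (S : {set 'I_n}) (j : 'I_n) :
    {set 'I_n} :=
  if cond_var (S :\ j) - cond_var S < threshold then S :\ j else S.

Definition greedy_and_prune (nu : R) (T : nat) (out : {set 'I_n}) : Prop :=
  exists (S : {set 'I_n}) (s : seq 'I_n),
    let theta_hat := (cond_var S)^-1 in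
    [/\ omp T S, perm_eq s (enum S) &
        out = foldl (prune_step (nu / theta_hat)) S s].

End Algorithms.

(* Main.v *)
Require Import Defs.
From mathcomp Require Import measurable_realfun zify ring lra.

Set Implicit Arguments.
Unset Strict Implicit.
Unset Printing Implicit Defensive.
Import Order.TTheory GRing.Theory Num.Theory.
Import numFieldNormedType.Exports.
Local Open Scope classical_set_scope.
Local Open Scope ring_scope.

(** Write Q for the population quadratic form of Sigma and H for that of the
empirical Gram matrix.  With k = T + d + 1, a chi-square tail bound and a union
bound over a net show that, with probability at least 1 - delta, H = (1 +- e) Q
with e = kappa / 200 on all vectors supported on at most k coordinates.  The
rest is deterministic.

Fix a node i, put theta = Theta_ii and h = Theta e_i / theta, so that e_i - h is
the true regression vector, supported on the neighbors of i and of l1 norm at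
most 1 by SDD.  Since h is Q-orthogonal to all vectors vanishing at i, the excess
theta (min_(supp w in S) H (e_i - w) - H h) is comparable, up to O(e^2), to
theta Q y, where y = r - h and r is the least squares residual for S.

SDD gives Q (e_i + s e_j) <= 1 / |Theta_ij|, with s the sign of Theta_ij.
Testing r against e_j + s (e_i - r) for all neighbors j and averaging with the
weights |Theta_ij| / theta, which sum to at most 1, an OMP step with excess D
gains at least D^2 / (9 (d + D)).  The excess is at most 2 / kappa^2 after one
step, at most d after O(1 / kappa^2) steps and at most kappa^2 / 100 after
O(d / kappa^2) steps.  A missing neighbor forces an excess of at least
kappa^2 / 2, while sets containing all the neighbors have excess between
- 5 e^2 and 0; this also separates the two cases of the pruning phase. *)

(** * Chi-square tails *)

Section Transfer.
Context {R : realType}.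
Import HBNNSimple.

(** Monotone convergence along simple functions increasing to [f]; the nonnegative weight [g]
    preserves monotonicity. *)
Lemma integral_comp_weight_approx d (T : measurableType d)
    (mu : {measure set T -> \bar R}) (g Y : T -> R) (f : R -> R)
    (mf : measurable_fun [set: R] (EFin \o f)) :
  measurable_fun setT g -> measurable_fun setT Y ->
  (forall x, 0 <= g x) -> (forall y, 0 <= f y) ->
  (\int[mu]_x (f (Y x) * g x)%:E =
   limn (fun n => \int[mu]_x (nnsfun_approx measurableT mf n (Y x) * g x)%:E))%E.
Proof.
move=> mg mY g0 f0.
rewrite -monotone_convergence//.
- apply: eq_integral => x _; apply/esym/cvg_lim => //.
  rewrite EFinM; under eq_fun do rewrite EFinM.
  apply: cvgeZr => //.
  by apply: cvg_nnsfun_approx => //= y _; rewrite lee_fin.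
- move=> n; apply/measurable_EFinP; apply: measurable_funM => //.
  by apply: measurableT_comp => //; exact: measurable_funP.
- by move=> n x _; rewrite lee_fin mulr_ge0.
- move=> x _ a b ab; rewrite lee_fin ler_wpM2r//.
  exact/lefP/nd_nnsfun_approx.
Qed.

Lemma integral_nnsfun_comp_weight d (T : measurableType d)
    (mu : {measure set T -> \bar R}) (g Y : T -> R) (h : {nnsfun R >-> R}) :
  measurable_fun setT g -> measurable_fun setT Y -> (forall x, 0 <= g x) ->
  (\int[mu]_x (h (Y x) * g x)%:E =
   \sum_(y \in range h) y%:E * \int[mu]_x (\1_(h @^-1` [set y]) (Y x) * g x)%:E)%E.
Proof.
move=> mg mY g0.
have mI y : measurable_fun setT (fun x => \1_(h @^-1` [set y]) (Y x) * g x).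
  apply: measurable_funM => //; apply: (measurableT_comp _ mY).
  exact: measurable_indic.
transitivity (\int[mu]_x (\sum_(y \in range h)
    (y%:E * (\1_(h @^-1` [set y]) (Y x) * g x)%:E)))%E.
  apply: eq_integral => x _; rewrite fimfunE.
  under [RHS]eq_fsbigr do rewrite -EFinM.
  rewrite fsumEFin//; congr EFin.
  rewrite !fsbig_finite//= mulr_suml; apply: eq_bigr => y _.
  by rewrite mulrA.
rewrite ge0_integral_fsum//.
- apply: eq_fsbigr => y; rewrite inE => -[z _ <-].
  rewrite ge0_integralZl ?lee_fin//.
  + exact/measurable_EFinP.
  + by move=> x _; rewrite lee_fin mulr_ge0.
- by move=> y; apply: emeasurable_funM => //; exact/measurable_EFinP.
(* Nonnegativity is required for every real [y], even a negative one: unless [y] is the value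
   [h (Y x)], the indicator vanishes. *)
- move=> y x _; have [->|yh] := eqVneq y (h (Y x)).
    by rewrite mule_ge0 ?lee_fin ?mulr_ge0.
  rewrite indicE memNset ?mul0r ?mule0//= => e.
  by rewrite e eqxx in yh.
Qed.

(** Equality on indicators extends to simple functions by linearity and then to nonnegative [f] by
    passing to the limit. The weights serve two purposes: a density in [integral_expR_sqr_normal],
    the other factors of a product in [integral_prod_independent]. *)
Lemma eq_integral_comp_weight d1 d2 (T1 : measurableType d1)
    (T2 : measurableType d2) (mu1 : {measure set T1 -> \bar R})
    (mu2 : {measure set T2 -> \bar R}) (g1 Y1 : T1 -> R) (g2 Y2 : T2 -> R)
    (f : R -> R) :
  measurable_fun setT g1 -> measurable_fun setT Y1 -> (forall x, 0 <= g1 x) ->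
  measurable_fun setT g2 -> measurable_fun setT Y2 -> (forall x, 0 <= g2 x) ->
  (forall A : set R, measurable A ->
    (\int[mu1]_x (\1_A (Y1 x) * g1 x)%:E =
     \int[mu2]_x (\1_A (Y2 x) * g2 x)%:E)%E) ->
  measurable_fun setT f -> (forall y, 0 <= f y) ->
  (\int[mu1]_x (f (Y1 x) * g1 x)%:E = \int[mu2]_x (f (Y2 x) * g2 x)%:E)%E.
Proof.
move=> mg1 mY1 g10 mg2 mY2 g20 eqA mf f0.
have mf' : measurable_fun [set: R] (EFin \o f) by exact/measurable_EFinP.
rewrite !(integral_comp_weight_approx _ mf')//.
congr (limn _); apply/funext => n.
rewrite !integral_nnsfun_comp_weight//.
by apply: eq_fsbigr => y _; rewrite eqA.
Qed.

End Transfer.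

(** * Expectation of a product of independent nonnegative factors *)

Section IndependentProduct.
Context {R : realType} {disp : measure_display} {Omega : measurableType disp}.
Variables (P : probability Omega R) (m : nat) (Y : 'I_m -> Omega -> R).
Hypothesis mY : forall k, measurable_fun setT (Y k).
Hypothesis indY : forall A : 'I_m -> set R, (forall k, measurable (A k)) ->
  P [set w | forall k, A k (Y k w)] = (\prod_(k < m) P (Y k @^-1` A k))%E.

Lemma integral_prod_independent (f : 'I_m -> R -> R) (e : 'I_m -> R) :
  (forall k, measurable_fun setT (f k)) -> (forall k y, 0 <= f k y) ->
  (forall k, \int[P]_w (f k (Y k w))%:E = (e k)%:E)%E ->
  (\int[P]_w (\prod_(k < m) f k (Y k w))%:E = (\prod_(k < m) e k)%:E)%E.
Proof.
have mpre k (A : set R) : measurable A -> measurable (Y k @^-1` A).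
  by move=> mA; rewrite -[X in measurable X]setTI; exact: mY.
have Eindic k (A : set R) : measurable A ->
    (\int[P]_w (\1_A (Y k w) : R)%:E = P (Y k @^-1` A))%E.
  by move=> mA; rewrite -[in RHS](setIT (Y k @^-1` A)) -integral_indic//; exact: mpre.
(* Indicators are replaced by arbitrary functions one coordinate at a time. *)
suff main j : (j <= m)%N -> forall (f : 'I_m -> R -> R) (e : 'I_m -> R),
    (forall k, measurable_fun setT (f k)) -> (forall k y, 0 <= f k y) ->
    (forall k, \int[P]_w (f k (Y k w))%:E = (e k)%:E)%E ->
    (forall k : 'I_m, (j <= k)%N ->
      exists2 A : set R, measurable A & f k = \1_A) ->
    (\int[P]_w (\prod_(k < m) f k (Y k w))%:E = (\prod_(k < m) e k)%:E)%E.
  move=> mf f0 fe; apply: (main m) => // k.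
  by rewrite leqNgt ltn_ord.
elim: j => [_|j IH jm] {}f {}e mf f0 fe ind.
  have [A mA fA] : exists2 A : 'I_m -> set R, (forall k, measurable (A k)) &
      forall k, f k = \1_(A k).
    have /choice[A AP] k : exists A : set R, measurable A /\ f k = \1_A.
      by have [A] := ind k isT; exists A.
    by exists A => k; have [] := AP k.
  transitivity (P [set w | forall k, A k (Y k w)]).
    have mB : measurable [set w | forall k, A k (Y k w)].
      rewrite (_ : mkset _ = \bigcap_(k in [set: 'I_m]) (Y k @^-1` A k)).
        by apply: fin_bigcap_measurable => // k _; exact: mpre.
      by apply/seteqP; split => w /= Aw k; [move=> _|]; exact: Aw.
    rewrite -[X in P X](setIT) -integral_indic//.
    apply: eq_integral => w _; congr EFin.
    under eq_bigr do rewrite fA.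
    rewrite indicE; case: (asboolP (forall k, A k (Y k w))) => [Aw|nAw].
      by rewrite mem_set// big1// => k _; rewrite indicE mem_set.
    rewrite memNset//; have /existsNP[k nAk] := nAw.
    by rewrite (bigD1 k)//= indicE memNset ?mul0r.
  rewrite indY// -prodEFin; apply: eq_bigr => k _.
  by rewrite -fe fA Eindic.
pose k0 := Ordinal jm.
pose g w := \prod_(k < m | k != k0) f k (Y k w).
pose c := \prod_(k < m | k != k0) e k.
have e0 k : 0 <= e k.
  by rewrite -lee_fin -fe; apply: integral_ge0 => w _; rewrite lee_fin.
have mg : measurable_fun setT g.
  rewrite /g; under eq_fun do rewrite -big_filter.
  by apply: measurable_prod => k _; exact: (measurableT_comp (mf k)).
have c0 : 0 <= c by apply: prodr_ge0.
transitivity (\int[P]_w (f k0 (Y k0 w) * c)%:E)%E; last first.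
  under eq_integral do rewrite mulrC EFinM /=.
  rewrite ge0_integralZl//; last 2 first.
    by apply/measurable_EFinP; exact: measurableT_comp.
    by move=> w _; rewrite lee_fin.
  by rewrite fe -EFinM [in RHS](bigD1 k0)//= mulrC.
under eq_integral do rewrite (bigD1 k0)//= -/(g _).
(* The factors other than [k0] form the weight [g] on one side and the constant [c] on the other, so
   it suffices to treat an indicator at [k0], where the induction hypothesis applies. *)
apply: (eq_integral_comp_weight (g2 := cst c)) => //.
- by move=> w; exact: prodr_ge0.
- move=> A mA.
  pose f' k := if k == k0 then \1_A else f k.
  pose e' k := if k == k0 then fine (P (Y k0 @^-1` A)) else e k.
  have prod_e' : \prod_(k < m) e' k = fine (P (Y k0 @^-1` A)) * c.
    rewrite (bigD1 k0)//= {1}/e' eqxx; congr (_ * _).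
    by apply: eq_bigr => k /negPf kk0; rewrite /e' kk0.
  transitivity (\int[P]_w (\prod_(k < m) f' k (Y k w))%:E)%E.
    apply: eq_integral => w _; rewrite (bigD1 k0)//= {1}/f' eqxx.
    congr (_ * _)%:E; apply: eq_bigr => k /negPf kk0.
    by rewrite /f' kk0.
  rewrite (IH (ltnW jm) f' e') ?prod_e'.
  + under eq_integral do rewrite mulrC EFinM /=.
    have mI : measurable_fun setT (fun w => (\1_A (Y k0 w) : R)%:E).
      apply/measurable_EFinP; apply: (measurableT_comp _ (mY k0)).
      exact: measurable_indic.
    rewrite ge0_integralZl//=.
    by rewrite Eindic// muleC EFinM fineK// ?fin_num_measure//; exact: mpre.
  + by move=> k; rewrite /f'; case: eqP => // _; exact: measurable_indic.
  + by move=> k y; rewrite /f'; case: eqP.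
  + move=> k; rewrite /f' /e'; case: eqP => // ->.
    by rewrite Eindic// fineK// ?fin_num_measure//; exact: mpre.
  + move=> k jk; rewrite /f'; case: eqP => [_|/eqP kk0]; first by exists A.
    apply: ind; rewrite ltn_neqAle jk andbT.
    by apply: contra kk0 => /eqP e1; apply/eqP/val_inj.
Qed.

End IndependentProduct.

(** * Exponential moments and deviations of a chi-square variable *)

Section ChiSquare.
Context {R : realType} {disp : measure_display} {Omega : measurableType disp}.
Variable P : probability Omega R.

(** Multiplying the density of standard deviation [sigma] by the exponential gives, with
    [s ^+ 2 = 1 - a], the factor [s^-1] times the density of standard deviation [sigma / s], which
    integrates to 1. *)
Lemma integral_expR_sqr_normal (Y : Omega -> R) (sigma a : R) :
  measurable_fun setT Y -> 0 < sigma -> a < 1 ->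
  (forall A : set R, measurable A -> P (Y @^-1` A) = normal_prob 0 sigma A) ->
  (\int[P]_w (expR (a / 2 * (Y w / sigma) ^+ 2))%:E
     = ((Num.sqrt (1 - a))^-1)%:E)%E.
Proof.
move=> mY s0 a1 lawY.
set s := Num.sqrt (1 - a).
have s_gt0 : 0 < s by rewrite sqrtr_gt0 subr_gt0.
have s2 : s ^+ 2 = 1 - a by rewrite sqr_sqrtr// subr_ge0 ltW.
have ss0 : sigma / s != 0 by rewrite mulf_neq0 ?invr_eq0 ?gt_eqF.
pose f (x : R) := expR (a / 2 * (x / sigma) ^+ 2).
have mf : measurable_fun setT f.
  apply: measurableT_comp => //; apply: measurable_funM => //.
  by apply: measurable_funX; apply: measurable_funM.
transitivity (\int[P]_w (f (Y w) * cst 1 w)%:E)%E.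
  by apply: eq_integral => w _; rewrite mulr1.
rewrite (@eq_integral_comp_weight _ _ _ _ _ P (@lebesgue_measure R) _ _
  (normal_pdf 0 sigma) id)//; first last.
- by move=> x; exact: expR_ge0.
- move=> A mA; transitivity (P (Y @^-1` A)).
    have mYA : measurable (Y @^-1` A).
      by rewrite -[X in measurable X]setTI; exact: mY.
    rewrite -[in RHS](setIT (Y @^-1` A)) -integral_indic//.
    by apply: eq_integral => w _; rewrite mulr1.
  rewrite lawY// /normal_prob [LHS]integral_mkcond; apply: eq_integral => x _.
  by rewrite patchE indicE; case: ifPn => _; rewrite ?mul1r ?mul0r.
- by move=> x; exact: normal_pdf_ge0.
- exact: measurable_normal_pdf.
transitivity (\int[@lebesgue_measure R]_x
   ((s^-1)%:E * (normal_pdf 0 (sigma / s) x)%:E))%E.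
  have sigma_neq0 : sigma != 0 by rewrite gt_eqF.
  have s_neq0 : s != 0 by rewrite gt_eqF.
  have peakE : s^-1 * normal_peak (sigma / s) = normal_peak sigma.
    rewrite /normal_peak -invfM; congr (_^-1).
    rewrite -{1}(ger0_norm (ltW s_gt0)) -sqrtr_sqr -sqrtrM ?sqr_ge0//.
    by congr Num.sqrt; field.
  apply: eq_integral => x _; rewrite -EFinM !normal_pdfE//=; congr EFin.
  rewrite [RHS]mulrA peakE mulrCA; congr (_ * _).
  rewrite /f /normal_fun -expRD; congr expR; rewrite subr0 !expr_div_n s2.
  by field; rewrite sigma_neq0 subr_eq0 eq_sym lt_eqF.
rewrite ge0_integralZl ?integral_normal_pdf ?mule1//.
- by apply/measurable_EFinP; exact: measurable_normal_pdf.
- by move=> x _; rewrite lee_fin normal_pdf_ge0.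
- by rewrite lee_fin invr_ge0 ltW.
Qed.

(** After squaring, this follows from [1 + x <= expR x] and [(1 - a) * (1 + a + 2 * a ^+ 2) = 1 + a
    ^+ 2 * (1 - 2 * a)]. Negative [a] is allowed, for the lower tail. *)
Lemma invsqrt_le_expR (a : R) : a <= 2^-1 ->
  (Num.sqrt (1 - a))^-1 <= expR ((a + 2 * a ^+ 2) / 2).
Proof.
move=> a2; have a1 : 0 < 1 - a by lra.
rewrite invf_ple ?posrE ?sqrtr_gt0 ?expR_gt0// -expRN.
rewrite -(@ler_pXn2r _ 2) ?nnegrE ?sqrtr_ge0 ?expR_ge0//.
rewrite sqr_sqrtr ?(ltW a1)// -expRM_natl.
have -> : 2%:R * - ((a + 2 * a ^+ 2) / 2) = - (a + 2 * a ^+ 2) :> R by field.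
rewrite expRN invf_ple ?posrE ?expR_gt0//.
apply: le_trans (expR_ge1Dx _).
rewrite -[leLHS]mul1r ler_pdivrMr//.
have : 0 <= a ^+ 2 * (1 - 2 * a) by rewrite mulr_ge0 ?sqr_ge0//; lra.
nra.
Qed.

Section Tail.
Variables (m : nat) (Y : 'I_m -> Omega -> R) (sigma : R).
Hypothesis mY : forall k, measurable_fun setT (Y k).
Hypothesis indY : forall A : 'I_m -> set R, (forall k, measurable (A k)) ->
  P [set w | forall k, A k (Y k w)] = (\prod_(k < m) P (Y k @^-1` A k))%E.
Hypothesis sigma0 : 0 < sigma.
Hypothesis lawY : forall k (A : set R), measurable A ->
  P (Y k @^-1` A) = normal_prob 0 sigma A.

Let W w := \sum_(k < m) (Y k w / sigma) ^+ 2.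

Let mW : measurable_fun setT W.
Proof.
apply: measurable_sum => k; apply: measurable_funX.
by apply: measurable_funM.
Qed.

(** The indicator of the event is at most [expR ((a * W - t) / 2)], whose expectation factors by
    independence. The sign of [a] selects the tail. *)
Lemma chi_square_chernoff (a t : R) : a <= 2^-1 ->
  (P [set w | (t <= a * W w)%R]
     <= (expR ((m%:R * (a + 2 * a ^+ 2) - t) / 2))%:E)%E.
Proof.
move=> a2; have a1 : a < 1 by apply: le_lt_trans a2 _; lra.
have mE : measurable [set w | t <= a * W w].
  rewrite -[X in measurable X]setTI; apply: measurable_fun_le => //.
  exact: measurable_funM.
pose F w := expR (- t / 2) * \prod_(k < m) expR (a / 2 * (Y k w / sigma) ^+ 2).
have FE w : F w = expR ((a * W w - t) / 2).
  rewrite /F -expR_sum -expRD; congr expR.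
  by rewrite -mulr_sumr -/(W w); field.
have mP : measurable_fun setT
    (fun w => \prod_(k < m) expR (a / 2 * (Y k w / sigma) ^+ 2)).
  apply: measurable_prod => k _; apply: measurableT_comp => //.
  apply: measurable_funM => //; apply: measurable_funX.
  by apply: measurable_funM.
have mF : measurable_fun setT F by exact: measurable_funM.
apply: (@le_trans _ _ (\int[P]_w (F w)%:E)%E).
  rewrite -[in leLHS](setIT [set w | t <= a * W w]) -integral_indic//.
  apply: ge0_le_integral => //.
  - exact/measurable_EFinP/measurable_indic.
  - exact/measurable_EFinP.
  - move=> w _; rewrite lee_fin FE indicE.
    case: (asboolP (t <= a * W w)) => [tW|ntW].
      rewrite mem_set//=; apply: le_trans (expR_ge1Dx _).
      by rewrite lerDl divr_ge0// subr_ge0.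
    by rewrite memNset ?expR_ge0.
under eq_integral do rewrite /F EFinM.
rewrite ge0_integralZl//=; last 2 first.
- exact/measurable_EFinP.
- by move=> w _; rewrite lee_fin prodr_ge0// => k _; exact: expR_ge0.
have -> : (\int[P]_w (\prod_(k < m) expR (a / 2 * (Y k w / sigma) ^+ 2))%:E =
    (\prod_(k < m) (Num.sqrt (1 - a))^-1)%:E)%E.
  apply: (integral_prod_independent mY indY
    (f := fun _ x => expR (a / 2 * (x / sigma) ^+ 2))) => [k|k y|k].
  - apply: measurableT_comp => //; apply: measurable_funM => //.
    by apply: measurable_funX; apply: measurable_funM.
  - exact: expR_ge0.
  - exact: (integral_expR_sqr_normal (mY k) sigma0 a1 (@lawY k)).
rewrite -EFinM lee_fin prodr_const card_ord.
apply: (@le_trans _ _ (expR (- t / 2) * expR ((a + 2 * a ^+ 2) / 2) ^+ m)).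
  rewrite ler_wpM2l ?expR_ge0// lerXn2r ?nnegrE ?invr_ge0 ?sqrtr_ge0 ?expR_ge0//.
  exact: invsqrt_le_expR.
rewrite -expRM_natl -expRD ler_expR le_eqVlt; apply/orP; left; apply/eqP.
by field.
Qed.

(** Chernoff with [a = e / 4] above and [a = - (e / 4)] below: both times [m * (a + 2 * a ^+ 2) - t]
    equals [- m * e ^+ 2 / 8], and [e <= 2] keeps [a <= 1 / 2]. *)
Lemma chi_square_deviation (e : R) : 0 < e <= 2 ->
  (P [set w | (m%:R * e <= `|W w - m%:R|)%R]
    <= (2 * expR (- (m%:R * e ^+ 2) / 16))%:E)%E.
Proof.
move=> /andP[e0 e2].
have mW' (a t : R) : measurable [set w | t <= a * W w].
  rewrite -[X in measurable X]setTI; apply: measurable_fun_le => //.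
  exact: measurable_funM.
apply: (@le_trans _ _ (P ([set w | m%:R * (1 + e) * (e / 4) <= e / 4 * W w]%R `|`
   [set w | - (m%:R * (1 - e) * (e / 4)) <= - (e / 4) * W w]%R))).
  apply: le_measure; rewrite ?inE.
  - rewrite -[X in measurable X]setTI; apply: measurable_fun_le => //.
    apply: measurableT_comp => //; exact: measurable_funB.
  - exact: measurableU.
  - move=> w /=; rewrite ler_normr => /orP[h|h]; [left|right].
      by rewrite mulrC ler_wpM2l//; lra.
    by rewrite mulNr lerN2 mulrC ler_wpM2r//; lra.
apply: le_trans (measureU2 _ _ _) _ => //.
have -> : 2 * expR (- (m%:R * e ^+ 2) / 16) =
  expR (- (m%:R * e ^+ 2) / 16) + expR (- (m%:R * e ^+ 2) / 16) by ring.
rewrite EFinD; apply: leeD.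
  apply: le_trans (chi_square_chernoff _ _) _; first by lra.
  rewrite lee_fin ler_expR le_eqVlt; apply/orP; left; apply/eqP; by field.
apply: le_trans (chi_square_chernoff _ _) _; first by lra.
rewrite lee_fin ler_expR le_eqVlt; apply/orP; left; apply/eqP; by field.
Qed.

End Tail.
End ChiSquare.

(** * Quadratic forms on coordinate subspaces *)

Section QuadraticForms.
Context {R : realType} {n : nat}.
Implicit Types (M A : 'M[R]_n) (u v x y z : 'cV[R]_n) (S : {set 'I_n}).

(** Discriminant criterion, by evaluation at the minimizer [f / a]. If [a = 0] and [f != 0], the
    affine function would take the value [- 1] at [(b + 1) / (2 * f)]. *)
Lemma sqr_le_of_quadratic_ge0 (a b f : R) : 0 <= a ->
  (forall s, 0 <= a * s ^+ 2 - 2 * f * s + b) -> f ^+ 2 <= a * b.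
Proof.
rewrite le_eqVlt => /predU1P[<-|a0] h.
  have [->|f0] := eqVneq f 0; first by rewrite expr0n mul0r.
  have := h ((b + 1) / (2 * f)).
  have -> : 0 * ((b + 1) / (2 * f)) ^+ 2 - 2 * f * ((b + 1) / (2 * f)) + b = - 1.
    by field.
  lra.
have := h (f / a).
have -> : a * (f / a) ^+ 2 - 2 * f * (f / a) + b = (a * b - f ^+ 2) / a.
  by field; rewrite gt_eqF.
by rewrite pmulr_lge0 ?invr_gt0// subr_ge0.
Qed.

Definition form M u v : R := (u^T *m M *m v) 0 0.
Definition qform M u : R := form M u u.

Lemma formDl M u v w : form M (u + v) w = form M u w + form M v w.
Proof. by rewrite /form linearD/= !mulmxDl mxE. Qed.

Lemma formDr M u v w : form M u (v + w) = form M u v + form M u w.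
Proof. by rewrite /form mulmxDr mxE. Qed.

Lemma formZl M a u v : form M (a *: u) v = a * form M u v.
Proof. by rewrite /form linearZ/= -!scalemxAl mxE. Qed.

Lemma formZr M a u v : form M u (a *: v) = a * form M u v.
Proof. by rewrite /form -scalemxAr mxE. Qed.

Lemma formNl M u v : form M (- u) v = - form M u v.
Proof. by rewrite -scaleN1r formZl mulN1r. Qed.

Lemma formNr M u v : form M u (- v) = - form M u v.
Proof. by rewrite -scaleN1r formZr mulN1r. Qed.

Lemma form0r M u : form M u 0 = 0.
Proof. by rewrite -(scale0r (0 : 'cV[R]_n)) formZr mul0r. Qed.

Lemma form_mxB M A u v : form (M - A) u v = form M u v - form A u v.
Proof. by rewrite /form mulmxBr mulmxBl !mxE. Qed.

Lemma formC M u v : M^T = M -> form M u v = form M v u.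
Proof.
move=> sM; rewrite /form; transitivity ((u^T *m M *m v)^T 0 0).
  by rewrite [RHS]mxE.
by rewrite !trmx_mul trmxK sM mulmxA.
Qed.

Lemma qformD M u v : M^T = M ->
  qform M (u + v) = qform M u + 2 * form M u v + qform M v.
Proof. by move=> sM; rewrite /qform formDl !formDr (formC v u)//; ring. Qed.

Lemma qformB M u v : M^T = M ->
  qform M (u - v) = qform M u - 2 * form M u v + qform M v.
Proof. by move=> sM; rewrite qformD// /qform formNr formNl formNr; ring. Qed.

Lemma qformZ M a u : qform M (a *: u) = a ^+ 2 * qform M u.
Proof. by rewrite /qform formZl formZr; ring. Qed.

Lemma qformN M u : qform M (- u) = qform M u.
Proof. by rewrite /qform formNl formNr opprK. Qed.

Lemma qform0 M : qform M 0 = 0. Proof. exact: form0r. Qed.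

Lemma form_deltal M (j : 'I_n) v :
  form M (delta_mx j 0) v = (M *m v) j 0.
Proof. by rewrite /form trmx_delta -mulmxA -rowE mxE. Qed.

Lemma form_sumr M u v :
  form M u v = \sum_j v j 0 * form M u (delta_mx j 0).
Proof.
rewrite /form mxE; apply: eq_bigr => j _.
by rewrite mulrC -colE [col _ _ _ _]mxE.
Qed.

Definition supported S u := forall j, u j 0 != 0 -> j \in S.

Lemma supported0 S : supported S 0.
Proof. by move=> j; rewrite mxE eqxx. Qed.

Lemma supportedD S u v : supported S u -> supported S v -> supported S (u + v).
Proof.
move=> su sv j; rewrite mxE; have [u0|/su//] := eqVneq (u j 0) 0.
by rewrite u0 add0r => /sv.
Qed.

Lemma supportedZ S a u : supported S u -> supported S (a *: u).
Proof. by move=> su j; rewrite mxE mulf_eq0 negb_or => /andP[_ /su]. Qed.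

Lemma supportedN S u : supported S u -> supported S (- u).
Proof. by move=> su; rewrite -scaleN1r; exact: supportedZ. Qed.

Lemma supportedB S u v : supported S u -> supported S v -> supported S (u - v).
Proof. by move=> su sv; apply: supportedD => //; exact: supportedN. Qed.

Lemma supported_delta S j : j \in S -> supported S (delta_mx j 0).
Proof.
move=> jS k; rewrite mxE eqxx andbT.
by case: (eqVneq k j) => [->//|_]; rewrite eqxx.
Qed.

Lemma supportedS S S' u : S \subset S' -> supported S u -> supported S' u.
Proof. by move=> /fintype.subsetP sS su j /su/sS. Qed.

Lemma supported_eq0 S u j : supported S u -> j \notin S -> u j 0 = 0.
Proof. by move=> su; apply: contraNeq; exact: su. Qed.

Lemma supported_setU1 S j u : supported (j |: S) u ->
  supported S (u - u j 0 *: delta_mx j 0).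
Proof.
move=> su k; rewrite !mxE eqxx andbT; have [->|kj] := eqVneq k j.
  by rewrite mulr1 subrr eqxx.
by rewrite mulr0 subr0 => /su; rewrite in_setU1 (negPf kj).
Qed.

Section PositiveSemidefinite.
Variable M : 'M[R]_n.
Hypothesis symM : M^T = M.
Hypothesis psdM : forall u, 0 <= qform M u.

Lemma form_cauchy_schwarz u v : form M u v ^+ 2 <= qform M u * qform M v.
Proof.
apply: sqr_le_of_quadratic_ge0 => // s.
have := psdM (s *: u - v); rewrite qformB// qformZ formZl; lra.
Qed.

Lemma form_null u v : qform M u = 0 -> form M u v = 0.
Proof.
move=> u0; have := form_cauchy_schwarz u v; rewrite u0 mul0r => h.
by apply/eqP; rewrite -sqrf_eq0 eq_le h sqr_ge0.
Qed.

Lemma qformD_le u v : qform M (u + v) <= 2 * qform M u + 2 * qform M v.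
Proof. by have := psdM (u - v); rewrite qformB// qformD//; lra. Qed.

(** Gram-Schmidt, adding one coordinate at a time. The form may be singular, as an empirical Gram
    matrix is for few samples; a new direction [f] of norm zero is orthogonal to everything by
    [form_null] and needs no correction. *)
Lemma form_projection S z :
  exists2 p, supported S p & forall v, supported S v -> form M (z - p) v = 0.
Proof.
move: {2}#|S| (erefl #|S|) z => k; elim: k S => [|k IH] S cS z.
  have S0 : S = finset.set0 by apply/eqP; rewrite -cards_eq0 cS.
  exists 0; first exact: supported0.
  move=> v sv; rewrite (_ : v = 0) ?form0r//.
  apply/matrixP => j l; rewrite ord1 mxE.
  by apply: (supported_eq0 sv); rewrite S0 inE.
have /card_gt0P[j jS] : (0 < #|S|)%N by rewrite cS.
pose S' := S :\ j.
have cS' : #|S'| = k by move: cS; rewrite (cardsD1 j) jS add1n => -[].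
have eS : S = j |: S' by rewrite finset.setD1K.
have [pj spj orth_j] := IH S' cS' (delta_mx j 0).
have [p sp orth] := IH S' cS' z.
pose f := delta_mx j 0 - pj : 'cV[R]_n.
have S'S : S' \subset S by exact: subD1set.
have sf : supported S f.
  by apply: supportedB; [exact: supported_delta|exact: supportedS spj].
have [f0|f0] := eqVneq (qform M f) 0.
  exists p; first exact: supportedS sp.
  move=> v; rewrite eS => /supported_setU1 sv.
  have -> : v = (v - v j 0 *: delta_mx j 0 + v j 0 *: pj) + v j 0 *: f.
    by rewrite /f scalerBr addrACA subrr addr0 subrK.
  rewrite formDr orth ?add0r; last by apply: supportedD => //; exact: supportedZ.
  by rewrite formZr formC// form_null ?mulr0.
pose a := form M z f / qform M f.
exists (p + a *: f).
  by apply: supportedD; [exact: supportedS sp|exact: supportedZ].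
move=> v; rewrite eS => /supported_setU1 sv.
have -> : v = (v - v j 0 *: delta_mx j 0 + v j 0 *: pj) + v j 0 *: f.
  by rewrite /f scalerBr addrACA subrr addr0 subrK.
set v' := (X in form _ _ (X + _)).
have sv' : supported S' v' by apply: supportedD => //; exact: supportedZ.
rewrite formDr formZr opprD addrA.
rewrite [form _ _ v']formDl orth// formNl formZl orth_j// mulr0 subr0 add0r.
rewrite [form _ _ f]formDl formDl !formNl formZl -/(qform M f).
by rewrite (formC p f)// orth_j// /a divfK// subr0 subrr mulr0.
Qed.

(* Points are added one coordinate at a time, along the component of [delta_mx
   j 0] orthogonal to the previous coordinates, so that errors add up. *)
Lemma supported_net (G : seq R) (rho : R) S : 0 <= rho -> (0 < size G)%N ->
  (forall a, `|a| <= 1 -> exists2 b, b \in G & (a - b) ^+ 2 <= rho) ->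
  exists L : seq 'cV[R]_n,
    [/\ (size L <= size G ^ #|S|)%N, forall v, v \in L -> supported S v &
        forall u, supported S u -> qform M u <= 1 ->
          exists2 v, v \in L & qform M (u - v) <= #|S|%:R * rho].
Proof.
move=> rho0 G0 netG; move: {2}#|S| (erefl #|S|) => k; elim: k S => [|k IH] S cS.
  have S0 : S = finset.set0 by apply/eqP; rewrite -cards_eq0 cS.
  exists [:: 0]; split.
  - by rewrite cS.
  - by move=> v; rewrite inE => /eqP ->; exact: supported0.
  - move=> u su _; exists 0; first by rewrite inE.
    rewrite (_ : u = 0) ?subr0 ?qform0 ?mulr_ge0//.
    apply/matrixP => j l; rewrite ord1 mxE.
    by apply: (supported_eq0 su); rewrite S0 inE.
have /card_gt0P[j jS] : (0 < #|S|)%N by rewrite cS.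
pose S' := S :\ j.
have cS' : #|S'| = k by move: cS; rewrite (cardsD1 j) jS add1n => -[].
have eS : S = j |: S' by rewrite finset.setD1K.
have S'S : S' \subset S by exact: subD1set.
have [L [sizeL suppL netL]] := IH S' cS'.
have [pj spj orth_j] := form_projection S' (delta_mx j 0).
pose f := delta_mx j 0 - pj : 'cV[R]_n.
have sf : supported S f.
  by apply: supportedB; [exact: supported_delta|exact: supportedS spj].
have decomp u : supported S u ->
    exists u' a, [/\ supported S' u', u = u' + a *: f &
      qform M u = qform M u' + a ^+ 2 * qform M f].
  rewrite {1}eS => /supported_setU1 su.
  exists (u - u j 0 *: delta_mx j 0 + u j 0 *: pj), (u j 0).
  have su' : supported S' (u - u j 0 *: delta_mx j 0 + u j 0 *: pj).
    by apply: supportedD => //; exact: supportedZ.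
  have eu : u = (u - u j 0 *: delta_mx j 0 + u j 0 *: pj) + u j 0 *: f.
    by rewrite /f scalerBr addrACA subrr addr0 subrK.
  split => //; rewrite {1}eu qformD// qformZ formZr (formC _ f)// orth_j//.
  by rewrite !mulr0 addr0.
(* A null component does not change [qform M], so the net for [S'] is kept; a nonempty [G] makes the
   size bound monotone in the dimension. *)
have [f0|f0] := eqVneq (qform M f) 0.
  exists L; split.
  - by rewrite (leq_trans sizeL)// cS cS' leq_pexp2l.
  - by move=> v /suppL; exact: supportedS.
  - move=> u /decomp[u' [a [su' eu]]]; rewrite f0 mulr0 addr0 => -> qu'.
    have [v vL qv] := netL u' su' qu'; exists v => //.
    rewrite eu addrAC qformD// qformZ f0 formZr formC// form_null//.
    rewrite !mulr0 !addr0; apply: le_trans qv _.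
    by rewrite ler_wpM2r// ler_nat cS cS'.
have qf_gt0 : 0 < qform M f by rewrite lt_neqAle eq_sym f0 psdM.
pose s := Num.sqrt (qform M f).
have s2 : s ^+ 2 = qform M f by rewrite sqr_sqrtr.
have s0 : 0 < s by rewrite sqrtr_gt0.
exists [seq v + (b / s) *: f | v <- L, b <- G]; split.
- by rewrite size_allpairs cS expnS mulnC leq_mul2l -cS' sizeL orbT.
- move=> _ /allpairsP[[v b] /= [vL bG ->]].
  by apply: supportedD; [exact: supportedS (suppL _ vL)|exact: supportedZ].
- move=> u /decomp[u' [a [su' eu ->]]] qu.
  have a2 : 0 <= a ^+ 2 * qform M f by rewrite mulr_ge0 ?sqr_ge0.
  have qu' : qform M u' <= 1 by lra.
  (* [a * s] is the coordinate of [u] along the unit vector [s^-1 *: f]; it is the number rounded to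
     the grid [G]. *)
  have as1 : `|a * s| <= 1.
    rewrite -(@ler_pXn2r _ 2) ?nnegrE// real_normK ?num_real// expr1n exprMn s2.
    by have := psdM u'; lra.
  have [v vL qv] := netL u' su' qu'.
  have [b bG ab] := netG _ as1.
  exists (v + (b / s) *: f); first by apply/allpairsP; exists (v, b).
  have -> : u - (v + (b / s) *: f) = (u' - v) + (a - b / s) *: f.
    by rewrite eu opprD addrACA scalerBl.
  rewrite qformD// qformZ formZr (formC _ f)// orth_j; last first.
    by apply: supportedB => //; exact: suppL.
  rewrite !mulr0 addr0.
  have -> : (a - b / s) ^+ 2 * qform M f = (a * s - b) ^+ 2.
    by rewrite -s2 -exprMn mulrBl divfK ?gt_eqF.
  rewrite cS -natr1 mulrDl mul1r lerD//; by rewrite -cS'.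
Qed.

(** The hypothesis at [s *: x + y] and [s *: x - y] bounds [4 * s * form A x y] by
    [2 * c * (s ^+ 2 * qform M x + qform M y)] for every [s]; the discriminant criterion concludes,
    although [A] itself may be indefinite. *)
Lemma form_polarization A (c : R) S : A^T = A -> 0 <= c ->
  (forall z, supported S z -> `|qform A z| <= c * qform M z) ->
  forall x y, supported S x -> supported S y ->
  form A x y ^+ 2 <= c ^+ 2 * (qform M x * qform M y).
Proof.
move=> symA c0 Ac x y sx sy.
have -> : c ^+ 2 * (qform M x * qform M y) =
  (c * qform M x) * (c * qform M y) by ring.
apply: sqr_le_of_quadratic_ge0 => [|s]; first by rewrite mulr_ge0.
have ssx : supported S (s *: x) by exact: supportedZ.
have /ler_normlP[_] := Ac _ (supportedD ssx sy).
have /ler_normlP[+ _] := Ac _ (supportedB ssx sy).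
by rewrite !(qformD, qformB)// !qformZ !formZl !formNr !qformN; lra.
Qed.

(** Let [K] be the supremum of [|qform A|] on the unit ball of [S], finite by the crude constant
    [c]. Writing [x = v + z] with [v] in the net, [|qform A v| <= 3 * e], the cross term is at most
    [2 * K / 8] and [|qform A z| <= K / 64]. Hence [K <= 3 * e + 17 / 64 * K]. *)
Lemma qform_le_of_net A (c e : R) S (L : seq 'cV[R]_n) : A^T = A -> 0 <= e ->
  (forall u, `|qform A u| <= c * qform M u) ->
  (forall v, v \in L -> supported S v) ->
  (forall u, supported S u -> qform M u <= 1 ->
    exists2 v, v \in L & qform M (u - v) <= 64^-1) ->
  (forall v, v \in L -> `|qform A v| <= e * qform M v) ->
  forall u, supported S u -> `|qform A u| <= 5 * e * qform M u.
Proof.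
move=> symA e0 Ac suppL netL AL.
have c0' u : 0 <= c * qform M u by apply: le_trans (Ac u).
pose E := [set r | exists u, [/\ supported S u, qform M u <= 1 & r = `|qform A u|]].
have E0 : E 0 by exists 0; rewrite !qform0 normr0; split => //; exact: supported0.
have ubE : ubound E `|c|.
  move=> r [u [_ qu ->]]; apply: le_trans (Ac u) _.
  apply: le_trans (ler_wpM2r (psdM u) (ler_norm c)) _.
  by rewrite ler_piMr.
have supE : has_sup E by split; [exists 0|exists `|c|].
pose K := sup E.
have K0 : 0 <= K by apply: ub_le_sup => //; exists `|c|.
have AK u : supported S u -> `|qform A u| <= K * qform M u.
  move=> su; have [u0|u0] := eqVneq (qform M u) 0.
    by rewrite u0 mulr0; apply: le_trans (Ac u) _; rewrite u0 mulr0.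
  have qu : 0 < qform M u by rewrite lt_neqAle eq_sym u0 psdM.
  pose s := Num.sqrt (qform M u).
  have s2 : s ^+ 2 = qform M u by rewrite sqr_sqrtr.
  have s0 : 0 < s by rewrite sqrtr_gt0.
  have : `|qform A (s^-1 *: u)| <= K.
    apply: ub_le_sup; first by exists `|c|.
    exists (s^-1 *: u); split => //; first exact: supportedZ.
    by rewrite qformZ exprVn s2 mulVf.
  rewrite qformZ normrM ger0_norm ?sqr_ge0// exprVn s2.
  by rewrite mulrC ler_pdivrMr.
suff K5 : K <= 5 * e.
  by move=> u su; apply: le_trans (AK u su) _; rewrite ler_wpM2r.
suff : K <= 3 * e + K * (17 / 64) by lra.
apply: ge_sup; first by exists 0.
move=> r [x [sx qx ->]].
have [v vL qz] := netL x sx qx.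
have sv := suppL v vL.
pose z := x - v.
have sz : supported S z by exact: supportedB.
have ev : v = x - z by rewrite /z opprB addrCA subrr addr0.
have Azx : `|form A z x| <= K / 8.
  rewrite -(@ler_pXn2r _ 2) ?nnegrE ?divr_ge0// real_normK ?num_real//.
  apply: le_trans (form_polarization symA K0 AK sz sx) _.
  have -> : (K / 8) ^+ 2 = K ^+ 2 * (64^-1 * 1) by field.
  by rewrite ler_wpM2l ?sqr_ge0// ler_pM.
have Az : `|qform A z| <= K / 64.
  by apply: le_trans (AK z sz) _; rewrite ler_wpM2l.
have Av : `|qform A v| <= 3 * e.
  apply: le_trans (AL v vL) _; rewrite mulrC ler_wpM2r//.
  have := qformD_le x (- z); rewrite -ev qformN.
  by move: qz; rewrite -/z; lra.
have := qformB x z symA; rewrite -ev (formC x z)//.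
move: Azx Az Av => /ler_normlP[? ?] /ler_normlP[? ?] /ler_normlP[? ?] ?.
by apply/ler_normlP; split; lra.
Qed.

(** The vector [w = invmx M *m delta_mx j 0] represents the coordinate [j] for the form [M] and has
    squared norm [invmx M j j]; this is Cauchy-Schwarz for [w] and [u]. *)
Lemma sqr_coord_le (j : 'I_n) u : M \in unitmx ->
  u j 0 ^+ 2 <= invmx M j j * qform M u.
Proof.
move=> Mu; pose w : 'cV[R]_n := invmx M *m delta_mx j 0.
have symI : (invmx M)^T = invmx M by rewrite trmx_inv symM.
have wM : w^T *m M = (delta_mx j 0)^T by rewrite trmx_mul symI mulmxKV.
have -> : u j 0 = form M w u.
  by rewrite /form wM trmx_delta -rowE mxE.
have -> : invmx M j j = qform M w.
  rewrite /qform /form wM trmx_delta -rowE mxE /w.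
  by rewrite -colE mxE.
exact: form_cauchy_schwarz.
Qed.

(** The size of the constant is irrelevant: it only makes the supremum in [qform_le_of_net]
    finite. *)
Lemma qform_bounded A : M \in unitmx ->
  exists c, forall u, `|qform A u| <= c * qform M u.
Proof.
move=> Mu.
exists (\sum_i \sum_j `|A i j| * ((invmx M i i + invmx M j j) / 2)) => u.
have -> : qform A u = \sum_i \sum_j A i j * (u i 0 * u j 0).
  rewrite /qform /form -mulmxA mxE; apply: eq_bigr => i _.
  rewrite !mxE big_distrr/=; apply: eq_bigr => j _; ring.
apply: le_trans (ler_norm_sum _ _ _) _.
rewrite mulr_suml; apply: ler_sum => i _.
apply: le_trans (ler_norm_sum _ _ _) _.
rewrite mulr_suml; apply: ler_sum => j _.
rewrite normrM -mulrA ler_wpM2l//.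
have := sqr_coord_le i u Mu; have := sqr_coord_le j u Mu.
have := sqr_ge0 (u i 0 - u j 0); have := sqr_ge0 (u i 0 + u j 0).
by rewrite sqrrD sqrrB => ? ? ? ?; apply/ler_normlP; split; lra.
Qed.

End PositiveSemidefinite.
End QuadraticForms.

(** * Restricted isometry of Gaussian samples *)

Section Gram.
Context {R : realType} {m n : nat}.
Implicit Type X : 'M[R]_(m, n).

Definition gram X : 'M[R]_n := m%:R^-1 *: (X^T *m X).

Lemma gram_sym X : (gram X)^T = gram X.
Proof. by rewrite /gram linearZ/= trmx_mul trmxK. Qed.

Lemma qform_gram X u : qform (gram X) u = m%:R^-1 * sqnorm (X *m u).
Proof.
rewrite /qform /form /gram -scalemxAr -scalemxAl mxE; congr (_ * _).
rewrite !mulmxA -trmx_mul -mulmxA mxE; apply: eq_bigr => k _.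
by rewrite mxE expr2.
Qed.

Lemma qform_gram_ge0 X u : 0 <= qform (gram X) u.
Proof.
by rewrite qform_gram mulr_ge0 ?invr_ge0// sumr_ge0// => k _; exact: sqr_ge0.
Qed.

End Gram.

(** * Deviation of the empirical form on a single vector *)

Section GaussianDeviation.
Context {R : realType} {disp : measure_display} {Omega : measurableType disp}.
Variables (P : probability Omega R) (m n : nat).
Variables (X : 'I_m -> {RV P >-> n.-tuple R}) (Sigma : 'M[R]_n).
Hypothesis covS : covariance_matrix Sigma.
Hypothesis iidX : iid_gaussian_samples X Sigma.

Lemma covariance_qform_ge0 u : 0 <= qform Sigma u.
Proof. by have := covS.2 u^T; rewrite trmxK. Qed.

Let lc (u : 'cV[R]_n) (x : n.-tuple R) : R := \sum_(i < n) u i 0 * tnth x i.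

Let mlc u : measurable_fun setT (lc u).
Proof.
apply: measurable_sum => i; apply: measurable_funM => //.
exact: measurable_tnth.
Qed.

Let mlcX u k : measurable_fun setT (fun w => lc u (X k w)).
Proof. exact: (measurableT_comp (mlc u)). Qed.

Let data_lc u w k : (data_matrix X w *m u) k 0 = lc u (X k w).
Proof. by rewrite !mxE; apply: eq_bigr => i _; rewrite mxE mulrC. Qed.

Let qform_data u w :
  qform (gram (data_matrix X w)) u = m%:R^-1 * \sum_k lc u (X k w) ^+ 2.
Proof.
by rewrite qform_gram; congr (_ * _); apply: eq_bigr => k _; rewrite data_lc.
Qed.

Definition bad_deviation (e : R) (u : 'cV[R]_n) : set Omega :=
  [set w | e * qform Sigma u < `|qform (gram (data_matrix X w) - Sigma) u|].

Lemma bad_deviation_measurable e u : measurable (bad_deviation e u).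
Proof.
rewrite [bad_deviation e u](_ : _ = ~` [set w |
    `|m%:R^-1 * (\sum_k lc u (X k w) ^+ 2) - qform Sigma u| <= e * qform Sigma u]).
  apply: measurableC.
  rewrite -[X in measurable X]setTI; apply: measurable_fun_le => //.
  apply: measurableT_comp => //; apply: measurable_funB => //.
  apply: measurable_funM => //; apply: measurable_sum => k.
  exact: measurable_funX.
by apply/seteqP; split => w;
  rewrite /bad_deviation /= -qform_data /qform form_mxB ltNge => /negP.
Qed.

(** The [m] values of the linear form [u] on the samples are independent centered normals of
    variance [qform Sigma u], so the ratio of the two forms at [u], times [m], is a chi-square
    variable. *)
Lemma bad_deviation_prob e u : (0 < m)%N -> 0 < e <= 2 -> Sigma \in unitmx ->
  (P (bad_deviation e u) <= (2 * expR (- (m%:R * e ^+ 2) / 16))%:E)%E.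
Proof.
move=> m0 e02 Su; have m0' : 0 < m%:R :> R by rewrite ltr0n.
have [symS _] := covS; have psdS := covariance_qform_ge0.
(* Since [Sigma] is invertible, a vector of norm zero is zero and the event is empty; this disposes
   of the degenerate normal law. *)
have [q0|q0] := eqVneq (qform Sigma u) 0.
  rewrite (_ : bad_deviation e u = set0) ?measure0 ?lee_fin ?mulr_ge0 ?expR_ge0//.
  have -> : u = 0.
    apply/matrixP => j l; rewrite ord1 mxE; apply/eqP.
    rewrite -sqrf_eq0 eq_le sqr_ge0 andbT.
    by apply: le_trans (sqr_coord_le symS psdS j u Su) _; rewrite q0 mulr0.
  by apply/seteqP; split => w //; rewrite /bad_deviation /= !qform0 mulr0 normr0 ltxx.
have qu : 0 < qform Sigma u by rewrite lt_neqAle eq_sym q0 psdS.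
pose sigma := Num.sqrt (qform Sigma u).
have sigma2 : sigma ^+ 2 = qform Sigma u by rewrite sqr_sqrtr.
have sigma0 : 0 < sigma by rewrite sqrtr_gt0.
have lawY k (A : set R) : measurable A ->
    P ((fun w => lc u (X k w)) @^-1` A) = normal_prob 0 sigma A.
  move=> mA; have := iidX.1 k u^T A mA.
  rewrite /centered_normal trmxK -/(form Sigma u u) -/(qform Sigma u) (negPf q0).
  rewrite -/sigma => <-; congr (P _); apply/seteqP; split => w /=;
    by under eq_bigr do rewrite mxE.
have indY (A : 'I_m -> set R) : (forall k, measurable (A k)) ->
    P [set w | forall k, A k (lc u (X k w))] =
    (\prod_(k < m) P ((fun w => lc u (X k w)) @^-1` A k))%E.
  move=> mA; have := iidX.2 finset.setT (fun k => lc u @^-1` A k).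
  rewrite (eq_bigl xpredT) => [<-|k]; last by rewrite inE.
    congr (P _); apply/seteqP; split => w /= H k; first by move=> _; exact: H.
    by apply: H; rewrite inE.
  by move=> k; rewrite -[X in measurable X]setTI; exact: mlc.
apply: le_trans (chi_square_deviation (mlcX u) indY sigma0 lawY e02).
apply: le_measure; rewrite ?inE.
- exact: bad_deviation_measurable.
- rewrite -[X in measurable X]setTI; apply: measurable_fun_le => //.
  apply: measurableT_comp => //; apply: measurable_funB => //.
  apply: measurable_sum => k; apply: measurable_funX.
  exact: measurable_funM.
- move=> w /ltW; rewrite /= /qform form_mxB -!/(qform _ _) qform_data -sigma2.
  have -> : \sum_(k < m) (lc u (X k w) / sigma) ^+ 2 =
      (\sum_k lc u (X k w) ^+ 2) / sigma ^+ 2.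
    by rewrite mulr_suml; apply: eq_bigr => k _; rewrite expr_div_n.
  set s := \sum_k _ => h.
  have -> : s / sigma ^+ 2 - m%:R = (m%:R^-1 * s - sigma ^+ 2) * (m%:R / sigma ^+ 2).
    by field; rewrite !gt_eqF.
  have c0 : 0 < m%:R / sigma ^+ 2 by rewrite divr_gt0// exprn_gt0.
  rewrite normrM (ger0_norm (ltW c0)).
  rewrite mulrA ler_pdivlMr ?exprn_gt0//.
  by rewrite -mulrA mulrC ler_wpM2r// ltW.
Qed.

End GaussianDeviation.

Section UnionBound.
Context {R : realType} {disp : measure_display} {Omega : measurableType disp}.
Variable P : probability Omega R.

Lemma union_bound_seq (T : eqType) (L : seq T) (bad : T -> set Omega) (p : R) :
  0 <= p -> (forall x, measurable (bad x)) -> (forall x, P (bad x) <= p%:E)%E ->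
  measurable [set w | exists2 x, x \in L & bad x w] /\
  (P [set w | exists2 x, x \in L & bad x w] <= ((size L)%:R * p)%:E)%E.
Proof.
move=> p0 mbad Pbad; elim: L => [|x L [mL PL]].
  rewrite (_ : mkset _ = set0); first by rewrite measure0 mul0r.
  by apply/seteqP; split => w // [].
rewrite (_ : mkset _ = bad x `|` [set w | exists2 x, x \in L & bad x w]); last first.
  apply/seteqP; split => w /=.
    move=> [y]; rewrite inE => /predU1P[->|yL] yw; [by left|right].
    by exists y.
  move=> [xw|[y yL yw]]; first by exists x; rewrite ?inE ?eqxx.
  by exists y; rewrite // inE yL orbT.
split; first exact: measurableU.
apply: le_trans (measureU2 _ _ _) _ => //.
by rewrite /= -natr1 mulrDl mul1r addrC EFinD leeD.
Qed.

End UnionBound.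

Lemma unit_interval_grid {R : realType} (N : nat) : (0 < N)%N ->
  exists G : seq R, [/\ (size G <= 3 * N)%N, (0 < size G)%N &
    forall a, `|a| <= 1 -> exists2 b, b \in G & (a - b) ^+ 2 <= (N%:R ^+ 2)^-1].
Proof.
move=> N0; have N0' : 0 < N%:R :> R by rewrite ltr0n.
exists [seq (i%:R / N%:R - 1) | i <- iota 0 (2 * N).+1].
rewrite size_map size_iota; split => //.
  by rewrite (_ : 3 = 2 + 1)%N// mulnDl mul1n -addn1 leq_add2l.
move=> a /ler_normlP[a1 a2].
have x0 : 0 <= (a + 1) * N%:R by rewrite mulr_ge0//; lra.
have /andP[t1 t2] := truncn_itv x0.
set t := Num.trunc _ in t1 t2.
exists (t%:R / N%:R - 1).
  apply/mapP; exists t => //; rewrite mem_iota/= add0n.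
  rewrite ltnS -(ler_nat R) natrM; apply: le_trans t1 _.
  by rewrite ler_wpM2r//; lra.
have -> : a - (t%:R / N%:R - 1) = ((a + 1) * N%:R - t%:R) / N%:R.
  by field; rewrite gt_eqF.
rewrite expr_div_n ler_pdivrMr ?exprn_gt0// mulVf ?expf_neq0 ?gt_eqF//.
by rewrite -natr1 in t2; rewrite expr_le1//; lra.
Qed.

Section RestrictedIsometry.
Context {R : realType} {disp : measure_display} {Omega : measurableType disp}.
Variables (P : probability Omega R) (m n : nat).
Variables (X : 'I_m -> {RV P >-> n.-tuple R}) (Sigma : 'M[R]_n).
Hypothesis covS : covariance_matrix Sigma.
Hypothesis Su : Sigma \in unitmx.
Hypothesis iidX : iid_gaussian_samples X Sigma.

(** There are at most [n ^ k] nets of at most [(24 * n) ^ k] points each. The deviation is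
    controlled by [e / 5] on the nets because extending it to subspaces costs a factor 5. *)
Lemma restricted_isometry_event (k : nat) (e delta : R) :
  (0 < m)%N -> (0 < n)%N -> 0 < e <= 1 ->
  (n%:R * (24 * n%:R)) ^+ k * (2 * expR (- (m%:R * (e / 5) ^+ 2) / 16)) <= delta ->
  exists E : set Omega, [/\ measurable E, ((1 - delta)%:E <= P E)%E &
    forall w, E w -> forall (S : {set 'I_n}) u, (#|S| <= k)%N -> supported S u ->
      `|qform (gram (data_matrix X w)) u - qform Sigma u| <= e * qform Sigma u].
Proof.
move=> m0 n0 /andP[e0 e1] hdelta.
have [symS _] := covS; have psdS := covariance_qform_ge0 covS.
(* With grid step [1 / (8 * n)], the net error is at most [n / (8 * n) ^ 2 <= 1 / 64]. *)
have [G [sizeG G0 gridG]] := @unit_interval_grid R (8 * n) ltac:(by rewrite muln_gt0).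
have /choice[L LP] (S : {set 'I_n}) : exists L : seq 'cV[R]_n,
    [/\ (size L <= (24 * n) ^ #|S|)%N, forall v, v \in L -> supported S v &
      forall u, supported S u -> qform Sigma u <= 1 ->
        exists2 v, v \in L & qform Sigma (u - v) <= 64^-1].
  have rho0 : 0 <= ((8 * n)%:R ^+ 2)^-1 :> R by rewrite invr_ge0 sqr_ge0.
  have [L [sizeL suppL netL]] := supported_net symS psdS S rho0 G0 gridG.
  exists L; split => //.
    apply: leq_trans sizeL _; have [->//|S0] := posnP #|S|.
    by rewrite leq_exp2r// (leq_trans sizeG)// mulnA.
  move=> u su qu; have [v vL qv] := netL u su qu; exists v => //.
  apply: le_trans qv _.
  rewrite ler_pdivrMr ?exprn_gt0 ?ltr0n ?muln_gt0//.
  have nS : #|S|%:R <= n%:R :> R by rewrite ler_nat -[leqRHS]card_ord max_card.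
  have n1 : 1 <= n%:R :> R by rewrite ler1n.
  by rewrite natrM; nra.
pose I := {ffun 'I_k -> 'I_n}.
pose LL := flatten [seq L [set f x | x in 'I_k]%SET | f : I].
have p0 : 0 <= 2 * expR (- (m%:R * (e / 5) ^+ 2) / 16) :> R.
  by rewrite mulr_ge0// expR_ge0.
have e52 : 0 < e / 5 <= 2 by apply/andP; split; lra.
have [mB PB] := union_bound_seq LL p0
  (fun u => bad_deviation_measurable X Sigma (e / 5) u)
  (fun u => bad_deviation_prob covS iidX u m0 e52 Su).
exists (~` [set w | exists2 u, u \in LL & bad_deviation X Sigma (e / 5) u w]).
split; first exact: measurableC.
  rewrite probability_setC// EFinB leeB//.
  apply: le_trans PB _; rewrite lee_fin; apply: le_trans hdelta.
  rewrite ler_wpM2r// -!natrM -natrX ler_nat size_flatten /shape -map_comp.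
  rewrite sumnE big_map big_enum/=.
  apply: (@leq_trans (\sum_(f : I) (24 * n) ^ k)%N).
    apply: leq_sum => f _; have [sizeL _ _] := LP [set f x | x in 'I_k]%SET.
    apply: leq_trans sizeL _; rewrite leq_pexp2l ?muln_gt0//.
    by rewrite -[leqRHS]card_ord leq_imset_card.
  by rewrite sum_nat_const card_ffun !card_ord -expnMn.
move=> w Ew S u Sk su.
pose i0 := Ordinal n0.
(* Enumerate [S] and pad with [i0]; the image may exceed [S], but it only has to contain it. *)
pose f : I := [ffun x : 'I_k => nth i0 (enum S) x].
have Sf : S \subset [set f x | x in 'I_k]%SET.
  apply/fintype.subsetP => s sS; apply/imsetP.
  have sk : (index s (enum S) < k)%N.
    by apply: leq_trans Sk; rewrite cardE index_mem mem_enum.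
  by exists (Ordinal sk); rewrite // ffunE nth_index// mem_enum.
have [_ suppL netL] := LP [set f x | x in 'I_k]%SET.
pose A := gram (data_matrix X w) - Sigma.
have symA : A^T = A by rewrite /A linearB/= gram_sym symS.
have [c Ac] := qform_bounded symS psdS A Su.
have e50 : 0 <= e / 5 by lra.
have -> : e * qform Sigma u = 5 * (e / 5) * qform Sigma u by field.
have -> : qform (gram (data_matrix X w)) u - qform Sigma u = qform A u.
  by rewrite /A /qform form_mxB.
apply: (qform_le_of_net symS psdS symA e50 Ac suppL netL) => [v vL|].
  rewrite leNgt; apply/negP => bad; apply: Ew.
  exists v => //; apply/flattenP; exists (L [set f x | x in 'I_k]%SET) => //.
  by rewrite /image_mem; apply/mapP; exists f; rewrite ?mem_enum.
exact: supportedS su.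
Qed.

End RestrictedIsometry.

(** * Diagonally dominant precision matrices *)

Section PrecisionMatrix.
Context {R : realType} {n : nat}.
Variable Sigma : 'M[R]_n.
Hypothesis symS : Sigma^T = Sigma.
Hypothesis psdS : forall u, 0 <= qform Sigma u.
Hypothesis Su : Sigma \in unitmx.
Let Theta := precision Sigma.

Lemma precision_sym : Theta^T = Theta.
Proof. by rewrite /Theta /precision trmx_inv symS. Qed.

Lemma precisionC i j : Theta i j = Theta j i.
Proof. by rewrite -{1}precision_sym mxE. Qed.

Lemma form_precision_col (j : 'I_n) v :
  form Sigma (Theta *m delta_mx j 0) v = v j 0.
Proof.
have symT := precision_sym.
rewrite /form trmx_mul symT mulmxKV// trmx_delta -rowE mxE//.
Qed.

Lemma qform_precision_col (j : 'I_n) :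
  qform Sigma (Theta *m delta_mx j 0) = Theta j j.
Proof. by rewrite /qform form_precision_col -colE mxE. Qed.

Lemma precision_diag_gt0 (j : 'I_n) : 0 < Theta j j.
Proof.
have T0 : 0 <= Theta j j by rewrite -qform_precision_col.
rewrite lt_neqAle T0 andbT eq_sym; apply/eqP => Tjj.
have : Theta *m delta_mx j 0 = 0 :> 'cV[R]_n.
  apply/matrixP => l k; rewrite ord1 [RHS]mxE; apply/eqP.
  rewrite -sqrf_eq0 eq_le sqr_ge0 andbT.
  apply: le_trans (sqr_coord_le symS psdS l _ Su) _.
  by rewrite qform_precision_col Tjj mulr0.
move/(congr1 (mulmx Sigma)); rewrite mulmx0 mulKVmx// => /matrixP/(_ j 0).
by rewrite !mxE !eqxx => /eqP; rewrite oner_eq0.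
Qed.

(** Diagonal dominance makes [qform Theta x] at least the sum over unordered pairs of the
    nonnegative terms [t k l]; one term is kept. The proof sums over ordered pairs, so everything
    appears twice. *)
Lemma SDD_qform_ge (i j : 'I_n) (x : 'cV[R]_n) : SDD Theta -> i != j ->
  `|Theta i j| * (x i 0 + Num.sg (Theta i j) * x j 0) ^+ 2 <= qform Theta x.
Proof.
move=> sdd ij; pose a k l := `|Theta k l|.
pose t k l := a k l * x k 0 ^+ 2 + a k l * x l 0 ^+ 2
  + 2 * (Theta k l * (x k 0 * x l 0)).
have aC k l : a k l = a l k by rewrite /a precisionC.
have tC k l : t k l = t l k by rewrite /t aC precisionC; ring.
have tE k l : t k l = `|Theta k l| * (x k 0 + Num.sg (Theta k l) * x l 0) ^+ 2.
  have [T0|T0] := eqVneq (Theta k l) 0.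
    by rewrite /t /a T0 normr0; ring.
  have s2 : Num.sg (Theta k l) ^+ 2 = 1 by rewrite sqr_sg T0.
  rewrite /t /a [in 2 * _](numEsg (Theta k l)).
  transitivity (`|Theta k l| * (x k 0 ^+ 2 + Num.sg (Theta k l) ^+ 2 * x l 0 ^+ 2
    + 2 * Num.sg (Theta k l) * x k 0 * x l 0)); last by ring.
  by rewrite s2; ring.
have t0 k l : 0 <= t k l by rewrite tE mulr_ge0// sqr_ge0.
have qE : qform Theta x = \sum_k Theta k k * x k 0 ^+ 2
    + \sum_k \sum_(l | l != k) Theta k l * (x k 0 * x l 0).
  rewrite -big_split/= /qform /form -mulmxA mxE; apply: eq_bigr => k _.
  rewrite !mxE big_distrr/= (bigD1 k)//=; congr (_ + _); first by ring.
  by apply: eq_bigr => l _; ring.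
have row : \sum_k \sum_(l | l != k) a k l * x k 0 ^+ 2 <=
    \sum_k Theta k k * x k 0 ^+ 2.
  apply: ler_sum => k _; rewrite -mulr_suml ler_wpM2r ?sqr_ge0//.
have col : \sum_k \sum_(l | l != k) a k l * x l 0 ^+ 2 =
    \sum_k \sum_(l | l != k) a k l * x k 0 ^+ 2.
  rewrite (exchange_big_dep xpredT)//=; apply: eq_bigr => k _.
  by apply: eq_big => [l|l _]; [rewrite eq_sym|rewrite aC].
have tsum : \sum_k \sum_(l | l != k) t k l =
    2 * (\sum_k \sum_(l | l != k) a k l * x k 0 ^+ 2)
    + 2 * \sum_k \sum_(l | l != k) Theta k l * (x k 0 * x l 0).
  transitivity (\sum_k \sum_(l | l != k) a k l * x k 0 ^+ 2
    + \sum_k \sum_(l | l != k) a k l * x l 0 ^+ 2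
    + 2 * \sum_k \sum_(l | l != k) Theta k l * (x k 0 * x l 0)).
    rewrite mulr_sumr -!big_split/=; apply: eq_bigr => k _.
    by rewrite mulr_sumr -!big_split/=.
  by rewrite col; ring.
have : t i j + t j i <= \sum_k \sum_(l | l != k) t k l.
  have ge_term (P : pred 'I_n) (f : 'I_n -> R) (l : 'I_n) : P l ->
      (forall l', 0 <= f l') -> f l <= \sum_(l' | P l') f l'.
    by move=> Pl f0; rewrite (bigD1 l)//= lerDl sumr_ge0.
  rewrite (bigD1 i)//= lerD//; first by apply: ge_term; rewrite // eq_sym.
  apply: le_trans (ge_term (fun k => k != i) _ j _ _); last 2 first.
  - by rewrite eq_sym.
  - by move=> k; exact: sumr_ge0.
  by apply: ge_term.
by rewrite (tC j i) -tE tsum qE; lra.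
Qed.

(** For [x = Sigma *m v], both [qform Theta x] and [x i 0 + s * x j 0] equal [qform Sigma v]. The
    previous lemma then bounds [|Theta i j|] times its square by itself. *)
Lemma SDD_edge_qform (i j : 'I_n) : SDD Theta -> i != j -> Theta i j != 0 ->
  qform Sigma (delta_mx i 0 + Num.sg (Theta i j) *: delta_mx j 0)
    <= `|Theta i j|^-1.
Proof.
move=> sdd ij T0; set s := Num.sg _; set v := _ + _.
pose x := Sigma *m v.
have xE : qform Sigma v = x i 0 + s * x j 0.
  by rewrite /qform formDl formZl !form_deltal.
have qx : qform Theta x = qform Sigma v.
  rewrite /qform /form /x trmx_mul symS -!mulmxA.
  by rewrite [invmx _ *m _]mulKmx.
have := SDD_qform_ge x sdd ij; rewrite qx -/s -xE => h.
have [q0|q0] := eqVneq (qform Sigma v) 0.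
  by rewrite q0 invr_ge0.
have qgt0 : 0 < qform Sigma v by rewrite lt_neqAle eq_sym q0 psdS.
move: h; rewrite expr2 mulrA -[leRHS]mul1r ler_pM2r// => h.
by rewrite -[leRHS]mul1r ler_pdivlMr ?normr_gt0// mulrC.
Qed.

Lemma nondegenerate_sqr (kappa : R) (i j : 'I_n) : 0 < kappa ->
  nondegenerate kappa Theta -> i != j -> Theta i j != 0 ->
  kappa ^+ 2 * (Theta i i * Theta j j) <= Theta i j ^+ 2.
Proof.
move=> k0 nd ij T0; have := nd i j ij T0.
have Tij : 0 < Theta i i * Theta j j by rewrite mulr_gt0 ?precision_diag_gt0.
rewrite ler_pdivlMr ?sqrtr_gt0// => h.
rewrite -(real_normK (num_real (Theta i j))) -{1}(sqr_sqrtr (ltW Tij)) -exprMn.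
by rewrite ler_pXn2r// nnegrE mulr_ge0 ?sqrtr_ge0// ltW.
Qed.

(** By diagonal dominance [|Theta i j| <= Theta j j], so one factor [|Theta i j|] cancels in the
    squared nondegeneracy inequality. *)
Lemma nondegenerate_edge_ge (kappa : R) (i j : 'I_n) : 0 < kappa ->
  SDD Theta -> nondegenerate kappa Theta -> i != j -> Theta i j != 0 ->
  kappa ^+ 2 * Theta i i <= `|Theta i j|.
Proof.
move=> k0 sdd nd ij T0; have := nondegenerate_sqr k0 nd ij T0.
have aj : `|Theta i j| <= Theta j j.
  apply: le_trans (sdd j); rewrite (bigD1 i)//= precisionC lerDl.
  by rewrite sumr_ge0.
have a0 : 0 < `|Theta i j| by rewrite normr_gt0.
have Ti := precision_diag_gt0 i.
rewrite -(real_normK (num_real (Theta i j))) => h.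
rewrite -(ler_pM2r a0) -expr2; apply: le_trans h.
by rewrite mulrA ler_wpM2l// mulr_ge0 ?sqr_ge0// ltW.
Qed.

End PrecisionMatrix.

(** * Orthogonal matching pursuit and pruning *)

Section LeastSquares.
Context {R : realType} {m n : nat}.
Variables (X : 'M[R]_(m, n)) (i : 'I_n).
Hypothesis m0 : (0 < m)%N.
Let H := gram X.
Let Hsym : H^T = H := gram_sym X.
Let Hpsd : forall u, 0 <= qform H u := qform_gram_ge0 X.
Let m0' : 0 < m%:R :> R. Proof. by rewrite ltr0n. Qed.

Lemma sqnorm_residual w :
  sqnorm (col i X - X *m w) = m%:R * qform H (delta_mx i 0 - w).
Proof.
by rewrite qform_gram mulVKf ?gt_eqF// mulmxBr -colE.
Qed.

Lemma rss_projection S : exists p, [/\ supported S p,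
  forall v, supported S v -> form H (delta_mx i 0 - p) v = 0 &
  rss X i S = m%:R * qform H (delta_mx i 0 - p)].
Proof.
have [p sp orth] := form_projection Hsym Hpsd S (delta_mx i 0).
exists p; split => //; apply/eqP; rewrite eq_le; apply/andP; split.
  apply: ge_inf; last by exists p => //; rewrite sqnorm_residual.
  by exists 0 => _ [w _ <-]; apply: sumr_ge0 => k _; exact: sqr_ge0.
apply: lb_le_inf; first by exists (sqnorm (col i X - X *m p)), p.
move=> _ [w sw <-]; rewrite sqnorm_residual ler_wpM2l ?(ltW m0')//.
have -> : delta_mx i 0 - w = (delta_mx i 0 - p) + (p - w) by rewrite addrA subrK.
rewrite [leRHS]qformD// orth; last by apply: supportedB.
by rewrite mulr0 addr0 lerDl.
Qed.

Lemma rss_le S w : supported S w -> rss X i S <= m%:R * qform H (delta_mx i 0 - w).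
Proof.
move=> sw; rewrite -sqnorm_residual; apply: ge_inf; last by exists w.
by exists 0 => _ [v _ <-]; apply: sumr_ge0 => k _; exact: sqr_ge0.
Qed.

Lemma rss_subset (S S' : {set 'I_n}) : S \subset S' -> rss X i S' <= rss X i S.
Proof.
move=> sS; have [p [sp _ ->]] := rss_projection S.
by apply: rss_le; exact: supportedS sp.
Qed.

End LeastSquares.

(** * Excess risk and the progress of one greedy step *)

Section Greedy.
Context {R : realType} {m n : nat}.
Variables (X : 'M[R]_(m, n)) (i : 'I_n) (Sigma : 'M[R]_n).
Variables (kappa e : R) (k d : nat).
Let Theta := precision Sigma.
Let theta := Theta i i.
Let N := neighbors Theta i.
Let H := gram X.
Hypothesis m0 : (0 < m)%N.
Hypothesis symS : Sigma^T = Sigma.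
Hypothesis psdS : forall u, 0 <= qform Sigma u.
Hypothesis Su : Sigma \in unitmx.
Hypothesis sdd : SDD Theta.
Hypothesis kappa0 : 0 < kappa.
Hypothesis nondeg : nondegenerate kappa Theta.
Hypothesis Nd : (#|N| <= d)%N.
Hypothesis e_bounds : 0 < e <= 100^-1.
Hypothesis rip : forall (S : {set 'I_n}) u, (#|S| <= k)%N -> supported S u ->
  `|qform H u - qform Sigma u| <= e * qform Sigma u.

Let Hsym : H^T = H := gram_sym X.
Let Hpsd : forall u, 0 <= qform H u := qform_gram_ge0 X.
Let m0' : 0 < m%:R :> R. Proof. by rewrite ltr0n. Qed.
Let theta0 : 0 < theta. Proof. exact: precision_diag_gt0. Qed.
Let e0 : 0 < e. Proof. by case/andP: e_bounds. Qed.
Let e1 : e <= 100^-1. Proof. by case/andP: e_bounds. Qed.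

(** [wst] is the true regression vector and [h] gives the population residual, whose variance
    [theta^-1] is the conditional variance of node [i]. *)
Let h : 'cV[R]_n := theta^-1 *: (Theta *m delta_mx i 0).
Let wst : 'cV[R]_n := delta_mx i 0 - h.

Let hE j : h j 0 = Theta i j / theta.
Proof.
by rewrite /h mxE -colE mxE mulrC; congr (_ / _); exact: precisionC.
Qed.

Let h_i : h i 0 = 1. Proof. by rewrite hE mulfV// gt_eqF. Qed.

Let wst_supp : supported N wst.
Proof.
move=> j; rewrite mxE [X in _ + X]mxE hE mxE eqxx andbT inE.
have [->|ji] := eqVneq j i; first by rewrite -hE h_i subrr eqxx.
rewrite sub0r oppr_eq0 mulf_eq0 negb_or => /andP[T0 _].
by rewrite /= T0.
Qed.

Let i_notin_N : i \notin N. Proof. by rewrite inE eqxx. Qed.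

Let qh : qform Sigma h = theta^-1.
Proof.
rewrite /h qformZ qform_precision_col// -/theta expr2 -mulrA mulVf ?mulr1//.
by rewrite gt_eqF.
Qed.

Let form_h v : form Sigma h v = v i 0 / theta.
Proof. by rewrite /h formZl form_precision_col// mulrC. Qed.

Let h_supp : supported (i |: N) h.
Proof.
have -> : h = delta_mx i 0 - wst by rewrite /wst opprB addrCA subrr addr0.
apply: supportedB; first by apply: supported_delta; rewrite in_setU1 eqxx.
by apply: supportedS wst_supp; exact: finset.subsetUr.
Qed.

(* Excess of the empirical risk over that of the true regression vector, in
   units of [1 / Theta i i]. *)
Definition excess (S : {set 'I_n}) : R := theta * (rss X i S / m%:R - qform H h).

Lemma excess_le S w : supported S w ->
  excess S <= theta * (qform H (delta_mx i 0 - w) - qform H h).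
Proof.
move=> sw; rewrite ler_wpM2l ?(ltW theta0)// lerD2r ler_pdivrMr// mulrC.
exact: rss_le.
Qed.

Lemma excess_subset (S S' : {set 'I_n}) : S \subset S' -> excess S' <= excess S.
Proof.
move=> sS; rewrite ler_wpM2l ?(ltW theta0)// lerD2r ler_pM2r ?invr_gt0//.
exact: rss_subset.
Qed.

Lemma excess_neighbors (S : {set 'I_n}) : N \subset S -> excess S <= 0.
Proof.
move=> NS; apply: le_trans (excess_le (supportedS NS wst_supp)) _.
have -> : delta_mx i 0 - wst = h by rewrite /wst opprB addrCA subrr addr0.
by rewrite subrr mulr0.
Qed.

Lemma qform_h_bounds : (d < k)%N -> 1 - e <= theta * qform H h <= 1 + e.
Proof.
move=> dk; have : (#|i |: N| <= k)%N.
  by rewrite cardsU1 i_notin_N add1n (leq_ltn_trans Nd).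
have tn0 : theta != 0 by rewrite gt_eqF.
move=> /rip/(_ h_supp); rewrite qh => /ler_normlP[h1 h2].
have := ler_wpM2l (ltW theta0) h2; have := ler_wpM2l (ltW theta0) h1.
have -> : theta * (e / theta) = e by field.
by rewrite mulrN mulrBr mulfV//; lra.
Qed.

(* With r the least squares residual of column i on S and y = r - h, the
   population norm of y is Y, B stands for the empirical product of h and y,
   and F for the empirical norm of y. *)
Lemma residual_bounds (S : {set 'I_n}) : i \notin S -> (#|S| + d < k)%N ->
  exists p Y B F,
  [/\ [/\ supported S p,
        forall v, supported S v -> form H (delta_mx i 0 - p) v = 0 &
        rss X i S / m%:R = qform H (delta_mx i 0 - p)],
      [/\ 0 <= Y, `|B| <= e * Y, (1 - e) * Y ^+ 2 <= F, F <= (1 + e) * Y ^+ 2 &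
        excess S = F + 2 * B],
      B + F = theta * form H (delta_mx i 0 - p) wst &
      forall j, j \in N -> j \notin S -> kappa <= Y].
Proof.
move=> iS Sk; have [p [sp orth rssE]] := rss_projection X i m0 S.
pose y := wst - p.
have ry : delta_mx i 0 - p = h + y by rewrite /y /wst addrCA addrA subrK.
pose U := i |: (S :|: N).
have Uk : (#|U| <= k)%N.
  rewrite cardsU1 finset.in_setU negb_or iS i_notin_N/= add1n.
  apply: leq_ltn_trans Sk; apply: leq_trans (leq_card_setU _ _) _.
  by rewrite leq_add2l.
have y_supp' : supported (S :|: N) y.
  by apply: supportedB; [apply: supportedS wst_supp; exact: finset.subsetUr|
    apply: supportedS sp; exact: finset.subsetUl].
have y_supp : supported U y by apply: supportedS y_supp'; exact: finset.subsetUr.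
have hU : supported U h.
  by apply: supportedS h_supp; rewrite finset.setUS// finset.subsetUr.
have yi : y i 0 = 0.
  by apply: (supported_eq0 y_supp'); rewrite finset.in_setU negb_or iS i_notin_N.
pose Y := Num.sqrt (theta * qform Sigma y).
have Y2 : Y ^+ 2 = theta * qform Sigma y.
  by rewrite sqr_sqrtr// mulr_ge0// ltW.
have Y0 : 0 <= Y by exact: sqrtr_ge0.
exists p, Y, (theta * form H h y), (theta * qform H y).
have rssH : rss X i S / m%:R = qform H (delta_mx i 0 - p).
  by rewrite rssE mulrC mulrA mulVf ?mul1r// gt_eqF.
split; [by split| split | | ] => //.
- rewrite -(@ler_pXn2r _ 2) ?nnegrE//; last by rewrite mulr_ge0// ltW.
  rewrite real_normK ?num_real//.
  (* As [y] vanishes at [i], its [Sigma]-product with [h] is zero: [B] consists of sampling error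
     only and is bounded by polarizing the isometry. *)
  pose A := H - Sigma.
  have symA : A^T = A by rewrite /A linearB/= Hsym symS.
  have ripA z : supported U z -> `|qform A z| <= e * qform Sigma z.
    by move=> sz; rewrite /qform form_mxB; exact: rip sz.
  have := form_polarization symS psdS symA (ltW e0) ripA hU y_supp.
  rewrite /A form_mxB form_h yi mul0r subr0 qh => Hhy.
  rewrite !exprMn Y2; apply: le_trans (ler_wpM2l (sqr_ge0 theta) Hhy) _.
  rewrite le_eqVlt; apply/orP; left; apply/eqP.
  by field; rewrite gt_eqF.
- have /ler_normlP[+ _] := rip Uk y_supp; rewrite Y2.
  have -> : (1 - e) * (theta * qform Sigma y) =
    theta * (qform Sigma y - e * qform Sigma y) by ring.
  by move=> ?; rewrite ler_wpM2l ?(ltW theta0)//; lra.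
- have /ler_normlP[_] := rip Uk y_supp; rewrite Y2.
  have -> : (1 + e) * (theta * qform Sigma y) =
    theta * (qform Sigma y + e * qform Sigma y) by ring.
  by move=> ?; rewrite ler_wpM2l ?(ltW theta0)//; lra.
- by rewrite /excess rssH ry qformD//; ring.
- have -> : form H (delta_mx i 0 - p) wst = form H (delta_mx i 0 - p) y.
    by rewrite /y [RHS]formDr formNr (orth _ sp) subr0.
  by rewrite ry formDl -/(qform H y); ring.
(* At a missing neighbor, [y] has the entry [- (Theta i j / theta)]; [sqr_coord_le] and
   nondegeneracy turn it into a lower bound on the norm of [y]. *)
- move=> j jN jS; move: (jN); rewrite inE => /andP[ji Tij].
  have ij : i != j by rewrite eq_sym.
  rewrite -(@ler_pXn2r _ 2) ?nnegrE ?(ltW kappa0)// Y2.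
  have yj : y j 0 = - (Theta i j / theta).
    rewrite mxE [X in _ + X]mxE (supported_eq0 sp jS) subr0.
    by rewrite mxE [X in _ + X]mxE hE mxE (negPf ji) sub0r.
  have := sqr_coord_le symS psdS j y Su; rewrite -/(precision Sigma) -/Theta yj.
  rewrite sqrrN => hy.
  have nd := nondegenerate_sqr symS psdS Su kappa0 nondeg ij Tij.
  have Tj : 0 < Theta j j by exact: precision_diag_gt0.
  rewrite -(ler_pM2r Tj) -(ler_pM2l theta0).
  apply: (@le_trans _ _ (Theta i j ^+ 2)).
    apply: le_trans nd; rewrite -/Theta -/theta.
    by rewrite le_eqVlt; apply/orP; left; apply/eqP; ring.
  have -> : Theta i j ^+ 2 = theta ^+ 2 * (Theta i j / theta) ^+ 2.
    by field; rewrite gt_eqF.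
  apply: le_trans (ler_wpM2l (sqr_ge0 theta) hy) _.
  by rewrite le_eqVlt; apply/orP; left; apply/eqP; ring.
Qed.

(** A missing neighbor forces [kappa <= Y], so the error [2 * e * Y] is at most [Y ^+ 2 / 100] and
    the excess is nearly [Y ^+ 2]. *)
Lemma excess_gap (S : {set 'I_n}) : i \notin S -> (#|S| + d < k)%N -> e <= kappa / 200 ->
  ~~ (N \subset S) -> kappa ^+ 2 / 2 <= excess S.
Proof.
move=> iS Sk ek /subsetPn[j jN jS].
have [p [Y [B [F [_ [Y0 BY FY _ ->] _ /(_ j jN jS) kY]]]]] := residual_bounds iS Sk.
move: BY => /ler_normlP[BY _].
have eY : e * Y <= kappa / 200 * Y by rewrite ler_wpM2r.
have kY2 : kappa * Y <= Y ^+ 2 by rewrite expr2 ler_wpM2r.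
have k2Y : kappa ^+ 2 <= kappa * Y by rewrite expr2 ler_wpM2l// ltW.
have eY2 : e * Y ^+ 2 <= 100^-1 * Y ^+ 2 by rewrite ler_wpM2r// sqr_ge0.
by have := sqr_ge0 kappa; lra.
Qed.

(** Here the residual is orthogonal to [wst], so [B = - F]. Then [F <= e * Y] forces [Y <= 2 * e],
    and the excess is [- F]. *)
Lemma excess_ge (S : {set 'I_n}) : i \notin S -> (#|S| + d < k)%N -> N \subset S ->
  - (5 * e ^+ 2) <= excess S.
Proof.
move=> iS Sk NS.
have [p [Y [B [F [[sp orth _] [Y0 BY FY FY' ->] BF _]]]]] := residual_bounds iS Sk.
move: BF; rewrite orth ?mulr0; last exact: supportedS wst_supp.
move: BY => /ler_normlP[BY _] BF.
have Y2 : Y <= 2 * e.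
  rewrite leNgt; apply/negP => eY.
  have Yp : 0 < Y by apply: lt_trans eY; rewrite mulr_gt0.
  have : (2 * e) * Y < Y ^+ 2 by rewrite expr2 ltr_pM2r.
  have : e * Y ^+ 2 <= 100^-1 * Y ^+ 2 by rewrite ler_wpM2r// sqr_ge0.
  have : 0 < e * Y by rewrite mulr_gt0.
  lra.
have : Y ^+ 2 <= (2 * e) ^+ 2 by apply: lerXn2r; rewrite ?nnegrE//; lra.
rewrite exprMn => h2; have : 0 <= e ^+ 2 by exact: sqr_ge0.
have : e * Y ^+ 2 <= 100^-1 * Y ^+ 2 by rewrite ler_wpM2r// sqr_ge0.
lra.
Qed.

(** [B + F] is the scaled correlation of the residual with [wst]. An excess above [130 * e ^+ 2]
    forces [10 * e <= Y], so [|B| <= Y ^+ 2 / 10] is small compared with [F]. *)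
Lemma excess_alignment (Y B F D : R) : 0 <= Y -> `|B| <= e * Y ->
  (1 - e) * Y ^+ 2 <= F -> F <= (1 + e) * Y ^+ 2 -> D = F + 2 * B ->
  130 * e ^+ 2 <= D -> 7 / 10 * D <= B + F.
Proof.
move=> Y0 /ler_normlP[B1 B2] F1 F2 -> D130.
have eY2 : e * Y ^+ 2 <= 100^-1 * Y ^+ 2 by rewrite ler_wpM2r// sqr_ge0.
have e2 : 0 < e ^+ 2 by rewrite exprn_gt0.
have Y10 : 10 * e <= Y.
  rewrite leNgt; apply/negP => Yle.
  have : Y ^+ 2 <= (10 * e) ^+ 2 by apply: lerXn2r; rewrite ?nnegrE//; lra.
  have : e * Y <= e * (10 * e) by rewrite ler_wpM2l ?(ltW e0)// ltW.
  by rewrite exprMn; move: D130 e2 eY2; rewrite !expr2; lra.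
have : (10 * e) * Y <= Y ^+ 2 by rewrite expr2 ler_wpM2r.
lra.
Qed.

Lemma omp_step_excess_le (S S' : {set 'I_n}) : omp_step X i S S' -> excess S' <= excess S.
Proof.
rewrite /omp_step; case: ifP => [_ ->//|_ [j _ ->]].
by apply: excess_subset; exact: finset.subsetUr.
Qed.

Lemma omp_step_best (S S' : {set 'I_n}) (j : 'I_n) :
  omp_step X i S S' -> j != i -> excess S' <= excess (j |: S).
Proof.
move=> + ji; rewrite /omp_step; case: ifPn => [/eqP SE ->|_ [l [_ best_l] ->]].
  have jS : j \in S by rewrite SE !inE.
  rewrite (_ : j |: S = S)//; apply/setP => l.
  by rewrite finset.in_setU1; case: eqP => // ->.
by rewrite ler_wpM2l ?(ltW theta0)// lerD2r ler_pM2r ?invr_gt0// best_l.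
Qed.

Lemma edge_qform_gram (j : 'I_n) : (1 < k)%N -> j \in N ->
  theta * qform H (delta_mx i 0 + Num.sg (Theta i j) *: delta_mx j 0)
    <= (1 + e) * (theta / `|Theta i j|).
Proof.
move=> k1; rewrite inE => /andP[ji Tij].
have ij : i != j by rewrite eq_sym.
set g := _ + _.
have card2 : (#|[set i; j]%SET| <= k)%N by rewrite cards2 ij.
have sg_ij : supported [set i; j]%SET g.
  apply: supportedD; first by apply: supported_delta; rewrite finset.in_set2 eqxx.
  by apply: supportedZ; apply: supported_delta; rewrite finset.in_set2 eqxx orbT.
have /ler_normlP[_ hg] := rip card2 sg_ij.
have := SDD_edge_qform symS psdS Su sdd ij Tij; rewrite -/Theta -/g => edge.
rewrite mulrCA ler_wpM2l ?(ltW theta0)//.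
apply: (@le_trans _ _ ((1 + e) * qform Sigma g)); first by lra.
by rewrite ler_wpM2l// addr_ge0// ltW.
Qed.

(** The gain [delta] bounds the correlations [b j] of the residual with all neighbors. Their average
    with weights [a j] dominates [B + F], hence [7 / 10] of the excess. *)
Lemma omp_step_progress (S S' : {set 'I_n}) :
  i \notin S -> (#|S| + d < k)%N -> (1 < k)%N -> (0 < d)%N -> omp_step X i S S' ->
  130 * e ^+ 2 <= excess S ->
  excess S ^+ 2 <= (excess S - excess S') * (9 * (d%:R + excess S)).
Proof.
move=> iS Sk k1 d0 step De.
have e2 : 0 < e ^+ 2 by rewrite exprn_gt0.
have step_le := omp_step_excess_le step.
have [p [Y [B [F [[sp orth rssE] [Y0 BY F1 F2 DE] BF _]]]]] := residual_bounds iS Sk.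
pose r := delta_mx i 0 - p.
have qr : theta * qform H r = excess S + theta * qform H h.
  by rewrite /excess rssE -/r; ring.
have /andP[_ qh1] : 1 - e <= theta * qform H h <= 1 + e.
  by apply: qform_h_bounds; apply: leq_ltn_trans Sk; exact: leq_addl.
pose D := excess S; pose delta := excess S - excess S'.
have delta0 : 0 <= delta by rewrite subr_ge0.
pose a j := `|Theta i j| / theta.
pose b j := theta * form H r (delta_mx j 0).
have a0 j : 0 <= a j by rewrite divr_ge0// ltW.
have b_le j : j \in N ->
    a j * b j ^+ 2 <= delta * (2 * (1 + e) + 2 * a j * (theta * qform H r)).
  move=> jN; move: (jN); rewrite inE => /andP[ji Tij].
  have bestj := omp_step_best step ji.
  have ij : i != j by rewrite eq_sym.
  pose s := Num.sg (Theta i j).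
  have s2 : s ^+ 2 = 1 by rewrite sqr_sg Tij.
  pose g : 'cV[R]_n := delta_mx i 0 + s *: delta_mx j 0.
  (* Adding [s *: p] leaves the product with the residual unchanged and makes [f] equal to [g - r]
     up to sign, where [g] is short by the edge bound. *)
  pose f : 'cV[R]_n := delta_mx j 0 + s *: p.
  have fE : f = s *: (g - r).
    have -> : g - r = p + s *: delta_mx j 0.
      by rewrite /g /r opprB addrC addrA subrK.
    by rewrite scalerDr scalerA -expr2 s2 scale1r addrC.
  have sf : supported (j |: S) f.
    apply: supportedD; first by apply: supported_delta; rewrite finset.in_setU1 eqxx.
    by apply: supportedZ; apply: supportedS sp; exact: finset.subsetUr.
  have form_rf : form H r f = form H r (delta_mx j 0).
    by rewrite /f formDr formZr (orth _ sp) mulr0 addr0.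
  have Tij0 : 0 < `|Theta i j| by rewrite normr_gt0.
  have aj0 : 0 < a j by rewrite divr_gt0.
  have qg : theta * qform H g <= (1 + e) / a j.
    by rewrite /a invf_div; exact: edge_qform_gram.
  have qf : theta * qform H f <= 2 * ((1 + e) / a j) + 2 * (theta * qform H r).
    rewrite fE qformZ s2 mul1r; have := qformD_le Hsym Hpsd g (- r).
    rewrite qformN => hh; have := ler_wpM2l (ltW theta0) hh; lra.
  (* The greedy choice does at least as well as moving by [t *: f]; nonnegativity for all [t] yields
     [b j ^+ 2 <= theta * qform H f * delta]. *)
  have gain t : 0 <= (theta * qform H f) * t ^+ 2 - 2 * b j * t + delta.
    have : supported (j |: S) (p + t *: f).
      apply: supportedD; last exact: supportedZ.
      by apply: supportedS sp; exact: finset.subsetUr.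
    move=> /excess_le; rewrite opprD addrA -/r => hh.
    have := le_trans bestj hh; rewrite qformB// qformZ formZr form_rf mulrBr.
    rewrite /delta /b -/D; rewrite /D; move: qr; lra.
  have := sqr_le_of_quadratic_ge0 _ gain.
  move=> /(_ ltac:(by rewrite mulr_ge0// ltW)) hb.
  apply: le_trans (ler_wpM2l (a0 j) hb) _.
  have -> : 2 * (1 + e) + 2 * a j * (theta * qform H r) =
      a j * (2 * ((1 + e) / a j) + 2 * (theta * qform H r)).
    by field; rewrite gt_eqF.
  have -> : a j * (theta * qform H f * delta) = delta * (a j * (theta * qform H f)).
    by ring.
  by rewrite ler_wpM2l// ler_wpM2l.
have suma : \sum_(j in N) a j <= 1.
  rewrite -mulr_suml ler_pdivrMr// mul1r; apply: le_trans (sdd i).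
  rewrite [leRHS](bigID (mem N))/= -[leLHS]addr0 lerD//.
    rewrite le_eqVlt; apply/orP; left; apply/eqP; apply: eq_bigl => j.
    by rewrite /N inE; case: eqP.
  by rewrite sumr_ge0.
have [beta betaE] : exists beta, beta = \sum_(j in N) a j * `|b j| by eexists.
have BF_beta : B + F <= beta.
  rewrite betaE BF form_sumr mulr_sumr (bigID (mem N))/= [X in _ + X]big1 ?addr0.
    apply: ler_sum => j jN; apply: le_trans (ler_norm _) _.
    rewrite mulrCA normrM -/(b j) ler_wpM2r//.
    move: jN; rewrite inE => /andP[/negPf ji _].
    rewrite mxE [X in _ + X]mxE hE mxE ji sub0r normrN normrM.
    by rewrite normfV (ger0_norm (ltW theta0)).
  by move=> j jN; rewrite (supported_eq0 wst_supp jN) mul0r mulr0.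
(* Jensen's inequality for weights of total mass at most 1. *)
have beta2 : beta ^+ 2 <= \sum_(j in N) a j * b j ^+ 2.
  have : 0 <= \sum_(j in N) a j * (`|b j| - beta) ^+ 2.
    by apply: sumr_ge0 => j _; rewrite mulr_ge0// sqr_ge0.
  have -> : \sum_(j in N) a j * (`|b j| - beta) ^+ 2 =
      \sum_(j in N) a j * b j ^+ 2 - 2 * beta * (\sum_(j in N) a j * `|b j|)
      + beta ^+ 2 * \sum_(j in N) a j.
    rewrite !mulr_sumr -sumrB -big_split/=; apply: eq_bigr => j _.
    by rewrite -(real_normK (num_real (b j))); ring.
  have := ler_wpM2l (sqr_ge0 beta) suma; rewrite -betaE mulr1 !expr2; lra.
have sumb : \sum_(j in N) a j * b j ^+ 2 <=
    delta * (2 * (1 + e) * d%:R + 2 * (theta * qform H r)).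
  apply: le_trans (ler_sum _ b_le) _.
  rewrite -mulr_sumr ler_wpM2l// big_split/= lerD//.
    rewrite sumr_const -[leLHS]mulr_natr ler_wpM2l ?ler_nat//.
    by rewrite mulr_ge0// addr_ge0// ltW.
  rewrite -mulr_suml -mulr_sumr.
  have q0 : 0 <= theta * qform H r by rewrite mulr_ge0// ltW.
  by have := ler_wpM2r q0 suma; lra.
have D7 := excess_alignment Y0 BY F1 F2 DE De.
have D0 : 0 <= excess S by apply: le_trans De; rewrite mulr_ge0// ltW.
have D2 : (7 / 10 * excess S) ^+ 2 <= beta ^+ 2.
  have Dbeta := le_trans D7 BF_beta.
  have D70 : 0 <= 7 / 10 * excess S by rewrite mulr_ge0.
  by apply: lerXn2r; rewrite ?nnegrE// (le_trans D70).
have d1 : 1 <= d%:R :> R by rewrite ler1n.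
(* The constant is [441 / 100 = 9 * (7 / 10) ^+ 2]. *)
have : delta * (2 * (1 + e) * d%:R + 2 * (theta * qform H r)) <=
    delta * (441 / 100 * (d%:R + excess S)).
  rewrite ler_wpM2l// qr.
  have : e * d%:R <= 100^-1 * d%:R by rewrite ler_wpM2r.
  by have := e1; lra.
move: D2; rewrite exprMn -/delta; lra.
Qed.

Lemma omp_support (T : nat) (S : {set 'I_n}) : omp X i T S ->
  i \notin S /\ (#|S| <= T)%N.
Proof.
elim: T S => [|T IH] S /=; first by move=> ->; rewrite inE cards0.
move=> [S0 /IH[iS0 S0T]]; rewrite /omp_step; case: ifP => [_ ->|_ [j [ji _] ->]].
  by split => //; exact: leqW.
split; first by rewrite finset.in_setU1 negb_or eq_sym ji.
by rewrite cardsU1; apply: (@leq_trans (1 + T)); rewrite ?leq_add ?leq_b1.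
Qed.

(** Ensures that the relation [greedy_and_prune] has an output, for the converse direction of
    correctness. *)
Lemma omp_exists (T : nat) : exists S, omp X i T S.
Proof.
elim: T => [|T [S ST]]; first by exists finset.set0.
suff [S' stepS] : exists S', omp_step X i S S' by exists S'; exists S.
rewrite /omp_step; have [_|SN] := boolP (S == [set~ i]%SET); first by exists S.
have [iS _] := omp_support ST.
have [j0 j0i] : exists j, j != i.
  have /subsetPn[j] : ~~ ([set~ i]%SET \subset S).
    apply: contra SN => iSS; rewrite finset.eqEsubset iSS andbT.
    by apply/fintype.subsetP => j jS; rewrite !inE; apply: contraNneq iS => <-.
  by rewrite !inE; exists j.
have [j ji jmin] := @Order.TotalTheory.arg_minP _ R 'I_n j0 (fun j => j != i)
  (fun j => rss X i (j |: S)) j0i.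
by exists (j |: S); exists j.
Qed.

(** * Number of greedy iterations *)

Section Iterations.
Hypothesis k1 : (1 < k)%N.
Hypothesis d0 : (0 < d)%N.
Hypothesis kappa1 : kappa <= 1.
Hypothesis e_kappa : e <= kappa / 200.

Let d1 : 1 <= d%:R :> R. Proof. by rewrite ler1n. Qed.

Let kappa2 : 0 < kappa ^+ 2. Proof. exact: exprn_gt0. Qed.

Let e_sqr : 130 * e ^+ 2 <= kappa ^+ 2 / 100.
Proof.
have : e ^+ 2 <= (kappa / 200) ^+ 2.
  by apply: lerXn2r; rewrite ?nnegrE ?divr_ge0 ?(ltW e0) ?(ltW kappa0).
by rewrite expr_div_n; have := kappa2; lra.
Qed.

Let kappa2_le1 : kappa ^+ 2 <= 1.
Proof. by rewrite expr_le1// ltW. Qed.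

(** The first choice is at least as good as a neighbor [j] with coefficient minus the sign of
    [Theta i j], for which the edge bound and [nondegenerate_edge_ge] apply. Without neighbors the
    excess is at most 0. *)
Lemma omp_first_step (S : {set 'I_n}) : omp X i 1 S -> excess S <= 2 / kappa ^+ 2.
Proof.
move=> /= [S0 -> step]; have [N0|[j jN]] := set_0Vmem N.
  have := omp_step_excess_le step.
  have := @excess_neighbors finset.set0; rewrite N0 finset.sub0set => /(_ isT) h1 h2.
  by apply: (le_trans h2 (le_trans h1 _)); rewrite divr_ge0// ltW.
move: (jN); rewrite inE => /andP[ji Tij].
have ij : i != j by rewrite eq_sym.
apply: le_trans (omp_step_best step ji) _.
have : supported (j |: finset.set0) (- (Num.sg (Theta i j) *: delta_mx j 0)).
  by apply/supportedN/supportedZ/supported_delta; rewrite finset.in_setU1 eqxx.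
move=> /excess_le; rewrite opprK mulrBr => h1.
have h2 := edge_qform_gram k1 jN.
have q0 : 0 <= theta * qform H h by rewrite mulr_ge0// ltW.
have Tij0 : 0 < `|Theta i j| by rewrite normr_gt0.
have edge : theta / `|Theta i j| <= (kappa ^+ 2)^-1.
  rewrite ler_pdivrMr// mulrC ler_pdivlMr// mulrC.
  exact: (nondegenerate_edge_ge symS psdS Su kappa0 sdd nondeg ij Tij).
have e11 : 1 + e <= 2 by have := e1; lra.
have : (1 + e) * (theta / `|Theta i j|) <= 2 / kappa ^+ 2.
  by rewrite ler_pM// ?divr_ge0 ?addr_ge0// ?ltW.
lra.
Qed.

(** While the excess [D] exceeds [d], [d + D <= 2 * D], so a step gains at least [D / 18], hence at
    least [1 / 18]. *)
Lemma omp_excess_le_degree (t : nat) (S : {set 'I_n}) :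
  omp X i t.+1 S -> (t.+1 + d < k)%N ->
  excess S <= d%:R \/ excess S <= 2 / kappa ^+ 2 - t%:R / 18.
Proof.
elim: t S => [|t IH] S.
  by move=> /omp_first_step; rewrite mul0r subr0; right.
move=> [S0]; rewrite -/(omp X i t.+1 S0) => ompS0 step tk.
have [iS0 S0t] := omp_support ompS0.
have S0k : (#|S0| + d < k)%N.
  by apply: leq_ltn_trans tk; rewrite leq_add2r leqW.
have S_le := omp_step_excess_le step.
have [Dd|Dd] := leP (excess S0) d%:R; first by left; exact: le_trans Dd.
case: (IH S0 ompS0 (ltnW tk)) => [|D0]; first by rewrite leNgt Dd.
right.
have D130 : 130 * e ^+ 2 <= excess S0.
  by have := e_sqr; have := kappa2_le1; have := d1; lra.
have prog := omp_step_progress iS0 S0k k1 d0 step D130.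
have D_gt0 : 0 < excess S0 by apply: lt_trans Dd; rewrite ltr0n.
have : excess S0 ^+ 2 <= (excess S0 - excess S) * (18 * excess S0).
  apply: le_trans prog _; rewrite ler_wpM2l ?subr_ge0//; lra.
rewrite expr2 mulrA ler_pM2r// => h1.
by rewrite -natr1; have := d1; lra.
Qed.

(** Once [D <= d], a step gains at least [D ^+ 2 / (18 * d)], so [1 / D] grows by at least
    [1 / (18 * d)] each time; the first alternative persists because the excess never increases. *)
Lemma omp_excess_decay (t0 t : nat) (S : {set 'I_n}) :
  (forall S0, omp X i t0 S0 -> excess S0 <= d%:R) ->
  omp X i (t0 + t) S -> (t0 + t + d < k)%N ->
  excess S <= d%:R /\ (excess S <= kappa ^+ 2 / 100 \/ excess S * t%:R <= 18 * d%:R).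
Proof.
move=> base; elim: t S => [|t IH] S.
  rewrite addn0 => /base Sd _; split => //; right.
  by rewrite mulr0 mulr_ge0.
rewrite addnS => -[S0 ompS0 step] tk.
have [iS0 S0t] := omp_support ompS0.
have S0k : (#|S0| + d < k)%N.
  by apply: leq_ltn_trans tk; rewrite leq_add2r leqW.
have S_le := omp_step_excess_le step.
have [D0d alt] := IH S0 ompS0 (ltnW tk).
split; first exact: le_trans D0d.
have [Dk|Dk] := leP (excess S0) (kappa ^+ 2 / 100); first by left; exact: le_trans Dk.
case: alt => [|D0t]; first by rewrite leNgt Dk.
right.
have D130 : 130 * e ^+ 2 <= excess S0 by have := e_sqr; lra.
have prog := omp_step_progress iS0 S0k k1 d0 step D130.
have D_gt0 : 0 < excess S0 by apply: lt_trans Dk; rewrite divr_gt0.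
pose c : R := 18 * d%:R; have c0 : 0 < c by rewrite mulr_gt0// ltr0n.
have D1 : excess S0 ^+ 2 <= (excess S0 - excess S) * c.
  apply: le_trans prog _; rewrite ler_wpM2l ?subr_ge0// /c; lra.
rewrite -/c in D0t *.
have cD : 0 <= c - excess S0 by rewrite /c; have := d1; lra.
rewrite -(ler_pM2r c0) -natr1.
(* The growth of the inverse without division: [h1] and [h2] bound [c] times the new excess times
   [t + 1] by [c ^+ 2 - excess S0 ^+ 2]. *)
have h1 : excess S0 * t%:R * (c - excess S0) <= c * (c - excess S0).
  by rewrite ler_wpM2r.
have h2 : excess S * c * (t%:R + 1) <= (excess S0 * (c - excess S0)) * (t%:R + 1).
  by rewrite ler_wpM2r ?addr_ge0//; move: D1; rewrite expr2; lra.
by have := sqr_ge0 (excess S0); rewrite expr2; lra.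
Qed.

(** With [q = 1 / kappa ^+ 2], about [36 * q] steps bring the excess from [2 * q] down to [d]. At
    least [1800 * d * q] steps remain, and [18 * d / (1800 * d * q) = kappa ^+ 2 / 100]. *)
Lemma omp_excess_final (T : nat) (S : {set 'I_n}) : (T + d < k)%N ->
  1840 * d%:R / kappa ^+ 2 <= T%:R -> omp X i T S -> excess S <= kappa ^+ 2 / 100.
Proof.
move=> Tk T_ge ompS.
pose q : R := (kappa ^+ 2)^-1.
have q1 : 1 <= q by rewrite /q invf_ge1.
have dq : q <= d%:R * q by rewrite ler_peMl ?d1// ltW// (lt_le_trans ltr01).
have q36 : 0 <= 36 * q by lra.
have /andP[s1 s2] := truncn_itv q36.
set s := Num.trunc _ in s1 s2.
have sT : (s.+2 <= T)%N.
  by rewrite -(ler_nat R) -!natr1; move: T_ge; rewrite -mulrA -/q; lra.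
have base S0 : omp X i s.+2 S0 -> excess S0 <= d%:R.
  move=> /omp_excess_le_degree[|//|h1].
    by apply: leq_ltn_trans Tk; rewrite leq_add2r.
  by move: h1; rewrite -/q -natr1; move: s2; rewrite -natr1; have := d1; lra.
have [_ [//|]] := @omp_excess_decay s.+2 (T - s.+2) S base
  ltac:(by rewrite subnKC) ltac:(by rewrite subnKC).
rewrite natrB// -[in s.+2%:R]addn2 natrD => h1.
have T2 : 1800 * (d%:R * q) <= T%:R - (s%:R + 2).
  by move: T_ge; rewrite -mulrA -/q; lra.
rewrite leNgt; apply/negP => D0.
have D_gt0 : 0 < excess S by apply: lt_trans D0; rewrite divr_gt0.
have := le_trans (ler_wpM2l (ltW D_gt0) T2) h1.
have -> : excess S * (1800 * (d%:R * q)) = (18 * d%:R) * (100 * excess S * q) by ring.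
rewrite -[leRHS]mulr1 ler_pM2l ?mulr_gt0 ?ltr0n// /q ler_pdivrMr// mul1r.
by move: D0; lra.
Qed.

Lemma omp_contains_neighbors (T : nat) (S : {set 'I_n}) : (T + d < k)%N ->
  1840 * d%:R / kappa ^+ 2 <= T%:R -> omp X i T S -> N \subset S.
Proof.
move=> Tk T_ge ompS; have [iS ST] := omp_support ompS.
have Sk : (#|S| + d < k)%N by apply: leq_ltn_trans Tk; rewrite leq_add2r.
apply/negPn/negP => NS; have := excess_gap iS Sk e_kappa NS.
by have := omp_excess_final Tk T_ge ompS; have := kappa2; lra.
Qed.

(** * Correctness of the pruning phase *)

Section Pruning.
Variable T : nat.
Hypothesis Tk : (T + d < k)%N.
Hypothesis Tm : (2 * T <= m)%N.
Hypothesis m_ge : 400 / kappa ^+ 2 <= m%:R.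

(** The degrees-of-freedom correction: [cond_var] divides by [m - #|S|], whereas [excess] is
    normalized by [m]. *)
Let ratio (S : {set 'I_n}) : R := m%:R / (m%:R - #|S|%:R).

Let ratio_bounds (S : {set 'I_n}) : (#|S| <= T)%N -> 1 <= ratio S <= 2.
Proof.
move=> ST; have S2m : 2 * #|S|%:R <= m%:R :> R.
  by rewrite -natrM ler_nat (leq_trans _ Tm)// leq_mul2l ST orbT.
have S0 : 0 <= #|S|%:R :> R by [].
have mS : 0 < m%:R - #|S|%:R :> R by have := m0'; lra.
by rewrite ler_pdivlMr// ler_pdivrMr//; apply/andP; split; lra.
Qed.

Let theta_cond_var (S : {set 'I_n}) :
  theta * cond_var X i S = (excess S + theta * qform H h) * ratio S.
Proof.
have -> : excess S + theta * qform H h = theta * (rss X i S / m%:R).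
  by rewrite /excess; ring.
rewrite /cond_var /ratio -!mulrA; congr (_ * _); congr (_ * _).
by rewrite mulrA mulVf ?mul1r// gt_eqF.
Qed.

Let qh_bounds : 1 - 100^-1 <= theta * qform H h <= 1 + 100^-1.
Proof.
have /andP[q1 q2] : 1 - e <= theta * qform H h <= 1 + e.
  by apply: qform_h_bounds; apply: leq_ltn_trans Tk; exact: leq_addl.
by have e1' := e1; apply/andP; split; lra.
Qed.

Let threshold (S0 : {set 'I_n}) := kappa ^+ 2 / 8 / (cond_var X i S0)^-1.

Let threshold_bounds (S0 : {set 'I_n}) : N \subset S0 -> i \notin S0 ->
  (#|S0| <= T)%N ->
  kappa ^+ 2 / 10 <= theta * threshold S0 <= kappa ^+ 2 * (3 / 10).
Proof.
move=> NS0 iS0 S0T.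
have S0k : (#|S0| + d < k)%N by apply: leq_ltn_trans Tk; rewrite leq_add2r.
have /andP[r1 r2] := ratio_bounds S0T.
have /andP[q1 q2] := qh_bounds.
have ex0 := excess_neighbors NS0; have ex1 := excess_ge iS0 S0k NS0.
have kap1 := kappa2_le1; have esq := e_sqr.
rewrite /threshold invrK mulrCA theta_cond_var.
set v := excess S0 + _.
have v1 : 9 / 10 <= v by rewrite /v; lra.
have v2 : v <= 1 + 100^-1 by rewrite /v; lra.
have vr1 : 9 / 10 * 1 <= v * ratio S0 by rewrite ler_pM.
have vr2 : v * ratio S0 <= (1 + 100^-1) * 2 by rewrite ler_pM//; lra.
have h1 := ler_wpM2l (ltW kappa2) vr1; have h2 := ler_wpM2l (ltW kappa2) vr2.
by have kap0 := kappa2; apply/andP; split; lra.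
Qed.

(** In units of [1 / theta], the threshold lies between [kappa ^+ 2 / 10] and
    [kappa ^+ 2 * (3 / 10)]. Dropping a neighbor raises the variance by nearly [kappa ^+ 2 / 2];
    dropping any other index raises it by at most [10 * e ^+ 2]. *)
Lemma prune_step_neighbors (S0 S : {set 'I_n}) (j : 'I_n) :
  N \subset S0 -> i \notin S0 -> (#|S0| <= T)%N ->
  N \subset S -> i \notin S -> (#|S| <= T)%N ->
  prune_step X i (threshold S0) S j = if j \in N then S else S :\ j.
Proof.
move=> NS0 iS0 S0T NS iS ST.
have Sk : (#|S| + d < k)%N by apply: leq_ltn_trans Tk; rewrite leq_add2r.
have SjS : S :\ j \subset S by exact: subD1set.
have iSj : i \notin S :\ j by apply: contra iS => /(fintype.subsetP SjS).
have cSj : (#|S :\ j| <= #|S|)%N by exact: subset_leq_card.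
have SjT : (#|S :\ j| <= T)%N by exact: leq_trans ST.
have Sjk : (#|S :\ j| + d < k)%N by apply: leq_ltn_trans Tk; rewrite leq_add2r.
have /andP[r1 r2] := ratio_bounds ST; have /andP[r1' r2'] := ratio_bounds SjT.
have /andP[q1 q2] := qh_bounds.
have /andP[t1 t2] := threshold_bounds NS0 iS0 S0T.
have kap1 := kappa2_le1; have esq := e_sqr; have kap0 := kappa2.
have e20 : 0 <= e ^+ 2 by exact: sqr_ge0.
rewrite /prune_step -(ltr_pM2l theta0) mulrBr !theta_cond_var.
have ex0 := excess_neighbors NS.
have mS (A : {set 'I_n}) : (#|A| <= T)%N -> 0 < m%:R - #|A|%:R :> R.
  move=> AT; have : 2 * #|A|%:R <= m%:R :> R.
    by rewrite -natrM ler_nat (leq_trans _ Tm)// leq_mul2l AT orbT.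
  have : 0 <= #|A|%:R :> R by [].
  by have := m0'; lra.
have [jN|jN] := boolP (j \in N).
  have gap : kappa ^+ 2 / 2 <= excess (S :\ j).
    apply: excess_gap => //; apply/subsetPn; exists j => //.
    by rewrite finset.in_setD1 eqxx.
  have jS : j \in S by apply: (fintype.subsetP NS).
  have ratio_diff : ratio S - ratio (S :\ j) <= kappa ^+ 2 / 100.
    have cS : #|S|%:R = #|S :\ j|%:R + 1 :> R.
      by rewrite natr1 (cardsD1 j S) jS add1n.
    have mS0 := mS S ST; have mSj := mS (S :\ j) SjT.
    (* Each ratio is at most 2 and [m] at least [400 / kappa ^+ 2], so the changed normalization
       costs at most [kappa ^+ 2 / 100]. *)
    have -> : ratio S - ratio (S :\ j) = ratio S * ratio (S :\ j) * m%:R^-1.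
      rewrite /ratio; move: mS0; rewrite cS => mS0.
      by field; rewrite !gt_eqF.
    apply: (@le_trans _ _ (2 * 2 * (kappa ^+ 2 / 400))); last by lra.
    rewrite ler_pM ?mulr_ge0 ?invr_ge0//; [lra|lra|by rewrite ler_pM//; lra|].
    have -> : kappa ^+ 2 / 400 = (400 / kappa ^+ 2)^-1 by rewrite invf_div.
    by rewrite lef_pV2 ?posrE ?divr_gt0.
  rewrite ltNge (_ : _ <= _)//.
  apply: le_trans t2 _.
  have h1 : (kappa ^+ 2 / 2 + theta * qform H h) * ratio (S :\ j) <=
      (excess (S :\ j) + theta * qform H h) * ratio (S :\ j).
    by rewrite ler_wpM2r//; lra.
  have h2 : (excess S + theta * qform H h) * ratio S <= theta * qform H h * ratio S.
    by rewrite ler_wpM2r//; lra.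
  have h3 : theta * qform H h * (ratio S - ratio (S :\ j)) <=
      (1 + 100^-1) * (kappa ^+ 2 / 100).
    apply: (@le_trans _ _ (theta * qform H h * (kappa ^+ 2 / 100))).
      by rewrite ler_wpM2l//; lra.
    by rewrite ler_wpM2r//; lra.
  have h4 : kappa ^+ 2 / 2 * 1 <= kappa ^+ 2 / 2 * ratio (S :\ j).
    by rewrite ler_wpM2l//; lra.
  lra.
rewrite (_ : _ < _)//.
have NSj : N \subset S :\ j by rewrite finset.subsetD1 NS.
have ex1 := excess_ge iS Sk NS; have ex2 := excess_neighbors NSj.
have ex3 := excess_ge iSj Sjk NSj.
have rr : ratio (S :\ j) <= ratio S.
  rewrite ler_wpM2l// lef_pV2 ?posrE ?mS// lerD2l lerN2 ler_nat//.
have h1 : (excess (S :\ j) + theta * qform H h) * ratio (S :\ j) <=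
    (excess (S :\ j) + theta * qform H h) * ratio S.
  by rewrite ler_wpM2l//; lra.
have h2 : (excess (S :\ j) - excess S) * ratio S <= 5 * e ^+ 2 * 2.
  apply: (@le_trans _ _ (5 * e ^+ 2 * ratio S)).
    by rewrite ler_wpM2r//; lra.
  by rewrite ler_wpM2l//; lra.
lra.
Qed.

(** The threshold stays that of the initial [S0] while [S] shrinks, so the two sets are separate;
    the conditions on [S] are invariants of the loop. *)
Lemma foldl_prune_step (S0 S : {set 'I_n}) (s : seq 'I_n) :
  N \subset S0 -> i \notin S0 -> (#|S0| <= T)%N ->
  N \subset S -> i \notin S -> (#|S| <= T)%N ->
  foldl (prune_step X i (threshold S0)) S s =
    [set x in S | (x \in N) || (x \notin s)]%SET.
Proof.
move=> NS0 iS0 S0T; elim: s S => [|j s IH] S NS iS ST /=.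
  by apply/setP => x; rewrite !inE orbT andbT.
rewrite prune_step_neighbors//; case: ifPn => jN.
  rewrite IH//; apply/setP => x; rewrite [LHS]finset.in_set [RHS]finset.in_set in_cons.
  by have [->|] := eqVneq x j; rewrite // jN.
have SjS : S :\ j \subset S by exact: subD1set.
rewrite IH//.
- apply/setP => x; rewrite [LHS]finset.in_set [RHS]finset.in_set in_setD1 in_cons.
  by have [->|] := eqVneq x j; rewrite //= (negPf jN) andbF.
- by rewrite finset.subsetD1 NS.
- by apply: contra iS => /(fintype.subsetP SjS).
- by apply: leq_trans ST; exact: subset_leq_card.
Qed.

Lemma greedy_and_prune_correct (S : {set 'I_n}) :
  1840 * d%:R / kappa ^+ 2 <= T%:R ->
  greedy_and_prune X i (kappa ^+ 2 / 8) T S <-> S = N.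
Proof.
move=> T_ge.
have prune S0 s : omp X i T S0 -> perm_eq s (enum S0) ->
    foldl (prune_step X i (threshold S0)) S0 s = N.
  move=> ompS0 s_S0; have [iS0 S0T] := omp_support ompS0.
  have NS0 := omp_contains_neighbors Tk T_ge ompS0.
  rewrite foldl_prune_step//; apply/setP => x.
  rewrite [LHS]finset.in_set (perm_mem s_S0) mem_enum andb_orr andbN orbF.
  by have [/(fintype.subsetP NS0) ->|] := boolP (x \in N); rewrite ?andbF.
split=> [[S0 [s [ompS0 s_S0 ->]]]|->]; first exact: prune.
have [S0 ompS0] := omp_exists T.
by exists S0, (enum S0); split => //; apply/esym; exact: prune.
Qed.

End Pruning.
End Iterations.

End Greedy.

(** * The sample size *)

Lemma max_degree_gt0_size (R : realType) (n : nat) (Theta : 'M[R]_n) :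
  (0 < max_degree Theta)%N -> (1 < n)%N.
Proof.
apply: contraLR; rewrite -!leqNgt => n1; apply/bigmax_leqP => i _.
rewrite leqn0 cards_eq0; apply/eqP/setP => j; rewrite !inE.
suff -> : j = i by rewrite eqxx.
apply: val_inj => /=; have := ltn_ord i; have := ltn_ord j; lia.
Qed.

Lemma card_neighbors_le (R : realType) (n : nat) (Theta : 'M[R]_n) (i : 'I_n) :
  (#|neighbors Theta i| <= max_degree Theta)%N.
Proof. exact: (@leq_bigmax _ (fun i => #|neighbors Theta i|)). Qed.

Lemma absz_ceil_bounds (R : realType) (x : R) : 0 <= x ->
  x <= (`|Num.ceil x|%N)%:R <= x + 1.
Proof.
move=> x0; have c0 : 0 <= Num.ceil x by rewrite ceil_ge0; lra.
rewrite natr_absz ger0_norm//; have /andP[] := ceil_itv x.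
by rewrite intrB => c1 c2; apply/andP; split; lra.
Qed.

(** From [1 - 1 / 2 <= expR (- 1 / 2)], that is [expR (1 / 2) <= 2]. *)
Lemma ge2_ln_ge (R : realType) (x : R) : 2 <= x -> 2^-1 <= ln x.
Proof.
move=> x2; have x0 : 0 < x by lra.
rewrite -ler_expR lnK ?posrE//.
have := expR_ge1Dx (- 2^-1 : R); rewrite expRN => h.
have : expR (2^-1 : R) <= 2.
  rewrite -[leRHS]invrK -[leLHS]invrK lef_pV2 ?posrE ?invr_gt0 ?expR_gt0//; lra.
lra.
Qed.

(** Put [x = n / delta]. Since [24 <= 2 ^ 5 <= n ^ 5], the base is at most [x ^ 7], and
    [2 <= n = x * delta]; everything becomes [delta] times an exponential with nonpositive
    exponent. *)
Lemma rip_failure_prob_le (R : realType) (n k m : nat) (e delta : R) :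
  (1 < n)%N -> 0 < delta < 1 ->
  (7 * k%:R + 1) * ln (n%:R / delta) <= m%:R * e ^+ 2 / 16 ->
  (n%:R * (24 * n%:R)) ^+ k * (2 * expR (- (m%:R * e ^+ 2) / 16)) <= delta.
Proof.
move=> n2 /andP[delta0 delta1] h.
have n2' : 2 <= n%:R :> R by rewrite ler_nat.
have n0 : 0 < n%:R :> R by lra.
have x0 : 0 < n%:R / delta by rewrite divr_gt0.
have nx : n%:R <= n%:R / delta by rewrite ler_pdivlMr// ler_piMr// ltW.
set L := ln _ in h.
have xE : n%:R / delta = expR L by rewrite lnK ?posrE.
have base : n%:R * (24 * n%:R) <= expR (7 * L).
  rewrite expRM_natl -xE.
  apply: (@le_trans _ _ (n%:R ^+ 7)); last by rewrite lerXn2r ?nnegrE ?(ltW n0) ?(ltW x0).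
  have -> : n%:R ^+ 7 = n%:R * (n%:R ^+ 5 * n%:R) :> R by ring.
  rewrite ler_wpM2l ?(ltW n0)// ler_wpM2r ?(ltW n0)//.
  apply: (@le_trans _ _ (2 ^+ 5)); first by lra.
  by rewrite lerXn2r ?nnegrE ?(ltW n0).
have pw : (n%:R * (24 * n%:R)) ^+ k <= expR (7 * k%:R * L).
  rewrite (_ : 7 * k%:R * L = k%:R * (7 * L)); last by ring.
  by rewrite expRM_natl lerXn2r ?nnegrE ?expR_ge0// !mulr_ge0// ltW.
have two : 2 <= expR L * delta by rewrite -xE divfK ?gt_eqF.
set Z := - (m%:R * e ^+ 2) / 16.
apply: (@le_trans _ _ (expR (7 * k%:R * L) * ((expR L * delta) * expR Z))).
  by rewrite ler_pM ?mulr_ge0 ?expR_ge0 ?exprn_ge0 ?mulr_ge0 ?(ltW n0)//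
    ler_wpM2r ?expR_ge0.
have -> : expR (7 * k%:R * L) * (expR L * delta * expR Z) =
    delta * expR (7 * k%:R * L + L + Z) by rewrite !expRD; ring.
by rewrite ler_piMr ?(ltW delta0)// -[leRHS]expR0 ler_expR /Z; lra.
Qed.

(* Opaque constants keep large unary numerals away from unification and [lra]. *)
Fact steps_constant (R : realType) : {c : R | c = 1840}.
Proof. by eexists. Qed.

Fact tail_constant (R : realType) : {W : R | W = 16 * 1000 ^+ 2}.
Proof. by eexists. Qed.

Fact entropy_constant (R : realType) : {K : R | K = 13 * 1000}.
Proof. by eexists. Qed.

Theorem theorem18 (R : realType) :
  exists c C : R, [/\ 0 < c, 0 < C &
  forall (n d m : nat) (kappa delta : R) (Sigma : 'M[R]_n)
    (disp : measure_display) (Omega : measurableType disp)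
    (P : probability Omega R) (X : 'I_m -> {RV P >-> n.-tuple R}),
  let Theta := precision Sigma in
  let nu := kappa ^+ 2 / 8 in
  let T := `|Num.ceil (c * d%:R / kappa ^+ 2)|%N in
  covariance_matrix Sigma -> Sigma \in unitmx ->
  0 < kappa <= 1 -> SDD Theta -> nondegenerate kappa Theta ->
  max_degree Theta = d -> (1 <= d)%N ->
  0 < delta < 1 ->
  iid_gaussian_samples X Sigma ->
  C * (d%:R ^+ 2 / kappa ^+ 6) * ln (n%:R / delta) <= m%:R ->
  exists E : set Omega, [/\ measurable E, ((1 - delta)%:E <= P E)%E &
    forall w, E w -> forall (i : 'I_n) (S : {set 'I_n}),
      greedy_and_prune (data_matrix X w) i nu T S <-> S = neighbors Theta i]].
Proof.
(* [W] comes from [(e / 5) ^+ 2 / 16] with [e / 5 = kappa / 1000]. [K] bounds [7 * k + 1] in units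
   of [Q = d / kappa ^+ 2], since [k <= 1843 * Q]. *)
pose W := sval (tail_constant R); pose K := sval (entropy_constant R).
pose c := sval (steps_constant R).
have W1 : 1 <= W.
  have : 1 <= 1000 ^+ 2 :> R by rewrite exprn_ege1// ler1n.
  by rewrite /W (svalP (tail_constant R)); lra.
have c0 : 0 < c by rewrite /c (svalP (steps_constant R)) ltr0n.
have K0 : 0 < K by rewrite /K (svalP (entropy_constant R)) mulr_gt0 ?ltr0n.
have W0 : 0 < W by apply: lt_le_trans W1.
exists c, (K * W); split => //; first exact: mulr_gt0.
move=> n d m kappa delta Sigma disp Omega P X Theta nu T covS Su /andP[k0 k1].
move=> sdd nondeg degE d0 delta01 iidX m_ge.
have n2 : (1 < n)%N by apply: (@max_degree_gt0_size _ _ Theta); rewrite degE.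
have n2' : 2 <= n%:R :> R by rewrite ler_nat.
pose e := kappa / 200.
have e01 : 0 < e <= 1 by rewrite /e; apply/andP; split; lra.
have e_small : 0 < e <= 100^-1 by rewrite /e; apply/andP; split; lra.
have [delta0 delta1] := andP delta01.
pose L := ln (n%:R / delta).
have L2 : 2^-1 <= L.
  apply: ge2_ln_ge; rewrite ler_pdivlMr//; apply: le_trans n2'.
  by rewrite ler_piMr// ltW.
pose q : R := (kappa ^+ 2)^-1.
have kappa2 : 0 < kappa ^+ 2 by rewrite exprn_gt0.
have kappa2_le1 : kappa ^+ 2 <= 1 by rewrite expr_le1// ltW.
have q1 : 1 <= q by rewrite /q invf_ge1.
have d1 : 1 <= d%:R :> R by rewrite ler1n.
pose Q := d%:R * q.
have dQ : d%:R <= Q by rewrite /Q ler_peMr.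
have qQ : q <= Q by rewrite /Q ler_peMl//; lra.
have Q1 : 1 <= Q by lra.
have T_bounds : c * Q <= T%:R <= c * Q + 1.
  have -> : c * Q = c * d%:R / kappa ^+ 2 by rewrite /Q /q; ring.
  have x0 : 0 <= c * d%:R / kappa ^+ 2.
    by rewrite divr_ge0 ?(ltW kappa2)// mulr_ge0// ltW.
  exact: absz_ceil_bounds x0.
have [T1 T2] := andP T_bounds.
have mk : K * W * (Q * L) <= m%:R * kappa ^+ 2.
  apply: le_trans (ler_wpM2r (ltW kappa2) m_ge).
  rewrite -/L; have -> : K * W * (d%:R ^+ 2 / kappa ^+ 6) * L * kappa ^+ 2 =
      K * W * (Q * Q * L).
    by rewrite /Q /q; field; rewrite gt_eqF.
  rewrite ler_pM2l ?mulr_gt0// -mulrA ler_peMl// mulr_ge0//; lra.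
(* [6500 = K / 2], from [1 / 2 <= L]; this covers [2 * T <= m] and [400 / kappa ^+ 2 <= m]. *)
have mQ : 65 * 100 * Q <= m%:R.
  apply: (@le_trans _ _ (K * W * (Q * L))).
    have h1 : Q * 2^-1 <= Q * L by rewrite ler_wpM2l//; lra.
    have h2 : 1 * (Q * 2^-1) <= W * (Q * L) by rewrite ler_pM//; lra.
    have h3 : K * (1 * (Q * 2^-1)) <= K * (W * (Q * L)) by rewrite ler_wpM2l// ltW.
    by rewrite -(mulrA K W); apply: le_trans h3;
      rewrite /K (svalP (entropy_constant R)); lra.
  by apply: le_trans mk _; rewrite ler_piMr.
have m0 : (0 < m)%N by rewrite -(ltr_nat R); lra.
(* Room for [T] selected columns, [d] neighbors and the node itself. *)
pose k := (T + d).+1.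
have kE : k%:R = T%:R + d%:R + 1 :> R by rewrite /k -natr1 natrD.
have prob : (n%:R * (24 * n%:R)) ^+ k *
    (2 * expR (- (m%:R * (e / 5) ^+ 2) / 16)) <= delta.
  apply: rip_failure_prob_le => //; rewrite -/L.
  have -> : m%:R * (e / 5) ^+ 2 / 16 = m%:R * kappa ^+ 2 / W.
    by rewrite /e /W (svalP (tail_constant R)); field.
  rewrite ler_pdivlMr//; apply: le_trans mk.
  have -> : K * W * (Q * L) = K * Q * L * W by ring.
  rewrite ler_wpM2r ?(ltW W0)// ler_wpM2r//; first by lra.
  by rewrite kE /K (svalP (entropy_constant R)); move: T2;
    rewrite /c (svalP (steps_constant R)); lra.
have [E [mE PE ripE]] := restricted_isometry_event covS Su iidX m0
  (ltnW n2) e01 prob.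
exists E; split=> // w Ew i S.
have [symS _] := covS.
apply: (@greedy_and_prune_correct R m n (data_matrix X w) i Sigma kappa e k d) => //.
- exact: covariance_qform_ge0 covS.
- by rewrite -degE; exact: card_neighbors_le.
- by move=> A u Ak su; exact: ripE su.
- by rewrite /k ltnS (leq_trans d0)// leq_addl.
- by rewrite -(ler_nat R) natrM; move: T2; rewrite /c (svalP (steps_constant R)); lra.
- have -> : 400 / kappa ^+ 2 = 400 * q by [].
  by lra.
- by rewrite -(svalP (steps_constant R)) -mulrA.
Qed.
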